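(* Let $[X,d,m]$ be a metric random walk space with invariant and reversible probability measure $\nu$, and assume $\Theta_m<\infty$. If the Ollivier-Ricci curvature satisfies $\kappa_m>0$, then $$W_1^d(\mu,\nu)\le\frac{\sqrt{2\Theta_m}}{\kappa_m}\sqrt{I_\nu(\mu)}\qquad\text{for all probability measures }\mu\ll\nu.$$
   Context: A metric random walk space $[X,d,m]$ is a Polish metric space $(X,d)$ with a family $m=(m_x)_{x\in X}$ of Borel probability measures, $x\mapsto m_x(A)$ Borel measurable, each with finite first moment. A Radon measure $\nu$ is invariant if $\nu(A)=\int_X m_x(A)d\nu(x)$ for all $\nu$-measurable $A$, reversible if $dm_x(y)d\nu(x)=dm_y(x)d\nu(y)$. $W_1^d$ is the $1$-Wasserstein distance: $W_1^d(\mu,\mu')=\inf_\gamma\int d(x,y)\,d\gamma$ over couplings $\gamma$ of $\mu,\mu'$. Ollivier-Ricci curvature: $\kappa_m=\inf_{x\ne y}\big(1-W_1^d(m_x,m_y)/d(x,y)\big)$. $\Theta_m=\operatorname{ess\,sup}_{x\in X}\frac12\int_X d(x,y)^2dm_x(y)$. $\mathcal H_m(f)=\frac12\iint(f(y)-f(x))^2dm_x(y)d\nu(x)$; $I_\nu(\mu)=2\mathcal H_m(\sqrt f)$ if $\mu=f\nu$, $f\ge0$, and $+\infty$ otherwise. *)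

(* Defs.v *)
From HB Require Import structures.
From mathcomp Require Import all_boot all_order all_algebra.
From mathcomp Require Import all_classical all_reals all_analysis ess_sup_inf.
Set Implicit Arguments. Unset Strict Implicit. Unset Printing Implicit Defensive.
Import Order.TTheory GRing.Theory Num.Theory.
Import numFieldNormedType.Exports.
Local Open Scope classical_set_scope.
Local Open Scope ring_scope.

Section MRWS.
Context {dX : measure_display} {X : measurableType dX} {R : realType}.

Definition is_metric (d : X -> X -> R) :=
  [/\ forall x y, 0 <= d x y,
      forall x y, d x y = 0 <-> x = y,
      forall x y, d x y = d y x &
      forall x y z, d x z <= d x y + d y z].

Definition dball (d : X -> X -> R) (x : X) (e : R) := [set y | d x y < e].

Definition dopen (d : X -> X -> R) (U : set X) :=
  forall x, U x -> exists e : R, 0 < e /\ dball d x e `<=` U.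

Definition dcomplete (d : X -> X -> R) :=
  forall u : nat -> X,
    (forall e : R, 0 < e -> exists N, forall n p, (N <= n)%N -> (N <= p)%N -> d (u n) (u p) < e) ->
    exists l, forall e : R, 0 < e -> exists N, forall n, (N <= n)%N -> d (u n) l < e.

Definition dseparable (d : X -> X -> R) :=
  exists s : nat -> X, forall x (e : R), 0 < e -> exists n, d x (s n) < e.

(* (X,d) is Polish and the measurable sets of X are exactly its Borel sets.
   The (Borel-)measurability of d on X x X is a consequence of this (product
   of Borel sigma-algebras of a separable space is the Borel sigma-algebra
   of the product); it is recorded explicitly so that integrals of d make sense. *)
Definition polish_borel (d : X -> X -> R) :=
  [/\ is_metric d, dcomplete d, dseparable d,
      (@measurable _ X) = <<s [set U | dopen d U] >> &
      measurable_fun setT (fun z : X * X => d z.1 z.2)].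

Definition first_moments (d : X -> X -> R) (m : R.-pker X ~> X) :=
  forall x, (\int[m x]_y (d x y)%:E < +oo)%E.

Definition mrw_invariant (m : R.-pker X ~> X) (nu : {measure set X -> \bar R}) :=
  forall A, measurable A -> nu A = (\int[nu]_x m x A)%E.

(* dm_x(y) dnu(x) = dm_y(x) dnu(y) as measures on X x X (tested on rectangles) *)
Definition mrw_reversible (m : R.-pker X ~> X) (nu : {measure set X -> \bar R}) :=
  forall A B, measurable A -> measurable B ->
    (\int[nu]_(x in A) m x B = \int[nu]_(x in B) m x A)%E.

Definition coupling (mu mu' : set X -> \bar R) (g : probability (X * X)%type R) :=
  forall A, measurable A -> g (A `*` setT) = mu A /\ g (setT `*` A) = mu' A.

Definition W1 (d : X -> X -> R) (mu mu' : set X -> \bar R) : \bar R :=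
  ereal_inf [set (\int[g]_z (d z.1 z.2)%:E)%E | g in coupling mu mu'].

Definition kappa (d : X -> X -> R) (m : R.-pker X ~> X) : \bar R :=
  ereal_inf [set r | exists x y, x <> y /\
     r = (1 - W1 d (m x) (m y) * ((d x y)^-1)%:E)%E].

Definition Theta (d : X -> X -> R) (m : R.-pker X ~> X) (nu : {measure set X -> \bar R}) : \bar R :=
  ess_sup nu (fun x => ((2^-1)%:E * \int[m x]_y ((d x y) ^+ 2)%:E)%E).

Definition Hm (m : R.-pker X ~> X) (nu : {measure set X -> \bar R}) (f : X -> R) : \bar R :=
  ((2^-1)%:E * \int[nu]_x \int[m x]_y ((f y - f x) ^+ 2)%:E)%E.

Definition density_of (nu : {measure set X -> \bar R}) (mu : set X -> \bar R) (f : X -> R) :=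
  [/\ measurable_fun setT f, forall x, 0 <= f x &
      forall A, measurable A -> mu A = (\int[nu]_(x in A) (f x)%:E)%E].

(* Fisher information I_nu(mu) = 2 H_m(sqrt f) if mu = f nu, +oo otherwise
   (the value does not depend on the version of f, so the infimum is that value) *)
Definition Inu (m : R.-pker X ~> X) (nu : {measure set X -> \bar R}) (mu : set X -> \bar R) : \bar R :=
  ereal_inf [set (2%:E * Hm m nu (fun x => Num.sqrt (f x)))%E | f in density_of nu mu].

End MRWS.

(* Main.v *)
Require Import Defs.
From HB Require Import structures.
From mathcomp Require Import all_boot all_order all_algebra.
From mathcomp Require Import all_classical all_reals all_analysis ess_sup_inf.
From mathcomp Require Import measurable_realfun ring lra.
Import Order.TTheory GRing.Theory Num.Theory.
Import numFieldNormedType.Exports.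
Set Implicit Arguments. Unset Strict Implicit. Unset Printing Implicit Defensive.
Local Open Scope classical_set_scope.
Local Open Scope ring_scope.

(** Write [P h x] for the integral of [h] against [m x]. Positive curvature
says that [P] multiplies Lipschitz constants by [1 - kappa]. Hence, if
[mu (h - P h) <= L * D] for every bounded [L]-Lipschitz [h], telescoping along
[P^n h] gives [mu h - nu h <= L * D / kappa], with no moment assumption because
[P^n h] tends to a constant; applied to Dirac masses this shows that [nu] has
a first moment, then so has [mu], and Kantorovich duality yields
[W1 mu nu <= D / kappa]. For [mu = f nu], reversibility gives
[mu (h - P h) = 1/2 \int\int (f x - f y) (h x - h y) m_x(dy) nu(dx)], and writing
[f x - f y] as a product of the difference and the sum of the square roots,
AM-GM with parameter [t] bounds it by [L * (t I / 4 + 2 Theta / t)]; then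
optimise over [t]. *)

(** * Kantorovich duality *)

(** [W1] is an infimum over couplings, so a bound on test functions has to be turned into actual
    couplings: this is the hard half of duality. Since the infimum need not be attained, couplings
    with a vanishing error suffice and no compactness is used. Test functions are bounded and
    nonnegative and the inequalities are written additively, so that the difference [h - P h] never
    has to be integrated. AM-GM replaces Cauchy-Schwarz for the same reason: for fixed [t] it is a
    pointwise inequality between nonnegative terms. The constant comes from
    [(a + b)^2 <= 2 a^2 + 2 b^2] and the symmetry of [nu(dx) m_x(dy)]: both squares contribute the
    same second moment, at most [2 Theta]. *)

(** Induction on the constraints. If [c <= 0] already follows without [j], give [j] weight 0.
    Otherwise some [x0] satisfies the other constraints with [0 < c x0], which forces [0 < a j x0];
    the induction hypothesis is applied after projecting along [x0], and evaluation at [x0] dictates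
    the weight of [j]. *)
Lemma farkas (F : realFieldType) (V : lmodType F) (I : eqType) (s : seq I)
    (a : I -> V -> F) (c : V -> F) :
  uniq s ->
  (forall i u v k, a i (u - k *: v) = a i u - k * a i v) ->
  (forall u v k, c (u - k *: v) = c u - k * c v) ->
  (forall x, (forall i, i \in s -> a i x <= 0) -> c x <= 0) ->
  exists l : I -> F, (forall i, 0 <= l i) /\
    forall x, c x = \sum_(i <- s) l i * a i x.
Proof.
elim: s a c => [|j s IHs] a c /= us alin clin ac.
  exists (fun=> 0); split=> // x; rewrite big_nil.
  have c0 : c 0 = 0.
    by have := clin 0 0 1; rewrite scale1r subr0 mul1r subrr.
  have cx : c x <= 0 by exact: ac.
  have : c (0 - 1 *: x) <= 0 by exact: ac.
  rewrite clin c0 mul1r sub0r oppr_le0 => cx'.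
  by apply/eqP; rewrite eq_le cx.
case/andP: us => js us.
have [[x0 [ax0 cx0]]|nx0] := pselect
  (exists x, (forall i, i \in s -> a i x <= 0) /\ 0 < c x); last first.
  have [x sx|l [l0 cE]] := IHs a c us alin clin.
    by rewrite leNgt; apply/negP => cx; apply: nx0; exists x.
  exists (fun i => if i == j then 0 else l i); split=> [i|x].
    by case: ifP.
  rewrite big_cons eqxx mul0r add0r cE; apply: eq_big_seq => i si.
  by case: eqP => // ij; rewrite ij (negPf js) in si.
have aj0 : 0 < a j x0.
  rewrite ltNge; apply/negP => aj; move: cx0; rewrite ltNge => /negP; apply.
  by apply: ac => i; rewrite in_cons => /predU1P[->//|]; exact: ax0.
(* project along [x0] onto the kernel of [a j] *)
pose e x := a j x / a j x0.
have elin u v k : e (u - k *: v) = e u - k * e v.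
  by rewrite /e alin mulrBl mulrA.
pose a' i x := a i (x - e x *: x0); pose c' x := c (x - e x *: x0).
have [| |x|l [l0 cE]] := IHs a' c' us.
- by move=> i u v k; rewrite /a' !alin elin; ring.
- by move=> u v k; rewrite /c' !clin elin; ring.
- move=> ax; apply: ac => i; rewrite in_cons => /predU1P[->|]; last exact: ax.
  by rewrite alin /e divfK ?subrr ?gt_eqF.
(* The weight of [j] is nonnegative since [c x0 > 0] while each [l i * a i x0 <= 0]. *)
exists (fun i => if i == j then (c x0 - \sum_(i <- s) l i * a i x0) / a j x0
                 else l i); split=> [i|x].
  case: ifP => // _; rewrite divr_ge0 ?(ltW aj0)// subr_ge0.
  rewrite (le_trans _ (ltW cx0))// big_seq sumr_le0// => k ks.
  by rewrite mulr_ge0_le0// ax0.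
have -> : c x = c' x + e x * c x0 by rewrite /c' clin subrK.
rewrite cE big_cons eqxx.
have -> : \sum_(i <- s) (if i == j then (c x0 - \sum_(i0 <- s) l i0 * a i0 x0) / a j x0
      else l i) * a i x = \sum_(i <- s) l i * a i x.
  apply: eq_big_seq => i si.
  by case: eqP => // ij; rewrite ij (negPf js) in si.
rewrite (eq_bigr (fun i => l i * a i x - e x * (l i * a i x0))); last first.
  by move=> i _; rewrite /a' alin; ring.
by rewrite sumrB -mulr_sumr /e; field; rewrite gt_eqF.
Qed.

(** Farkas applied to the dual problem made homogeneous: the extra coordinate [x.2] scales the cost,
    so that the constraints on potentials cut out a cone. The multipliers of the constraints
    [Some (i, j)] are the plan; that of [None] is the slack in the cost bound. *)
Lemma finite_kantorovich (F : realFieldType) (I : finType) (c : I -> I -> F)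
    (p q : I -> F) (D : F) :
  (forall i, 0 <= p i) -> (forall i, 0 <= q i) ->
  \sum_i p i = 1 -> \sum_i q i = 1 ->
  (forall u v : I -> F, (forall i j, u i + v j <= c i j) ->
    \sum_i u i * p i + \sum_j v j * q j <= D) ->
  exists w : I -> I -> F,
    [/\ forall i j, 0 <= w i j, forall i, \sum_j w i j = p i,
        forall j, \sum_i w i j = q j & \sum_i \sum_j w i j * c i j <= D].
Proof.
move=> p0 q0 p1 q1 dual.
pose V : lmodType F := ({ffun I -> F^o} * {ffun I -> F^o} * F^o)%type.
pose a (k : option (I * I)) (x : V) : F :=
  if k is Some (i, j) then x.1.1 i + x.1.2 j - c i j * x.2 else - x.2.
pose b (x : V) : F :=
  \sum_i x.1.1 i * p i + \sum_j x.1.2 j * q j - D * x.2.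
pose s := None :: [seq Some k | k <- index_enum (I * I)%type].
have us : uniq s.
  rewrite /= map_inj_uniq ?index_enum_uniq ?andbT; last by move=> ? ? [].
  by apply/mapP => -[].
have sE (G : option (I * I) -> F) :
    \sum_(k <- s) G k = G None + \sum_i \sum_j G (Some (i, j)).
  by rewrite big_cons big_map pair_big /=; congr (_ + _); apply: eq_bigr => -[].
have l1 (u v : V) t i : (u - t *: v).1.1 i = u.1.1 i - t * v.1.1 i.
  by rewrite -[LHS]/((u.1.1 - t *: v.1.1) i) !ffunE.
have l2 (u v : V) t i : (u - t *: v).1.2 i = u.1.2 i - t * v.1.2 i.
  by rewrite -[LHS]/((u.1.2 - t *: v.1.2) i) !ffunE.
have l3 (u v : V) t : (u - t *: v).2 = u.2 - t * v.2 by [].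
have alin k u v t : a k (u - t *: v) = a k u - t * a k v.
  by case: k => [[i j]|]; rewrite /a l3 ?l1 ?l2; ring.
have sumlin (f g r : I -> F) t : \sum_i (f i - t * g i) * r i =
    \sum_i f i * r i - t * \sum_i g i * r i.
  by rewrite mulr_sumr -sumrB; apply: eq_bigr => i _; ring.
have blin u v t : b (u - t *: v) = b u - t * b v.
  have s1 : \sum_i (u - t *: v).1.1 i * p i =
      \sum_i u.1.1 i * p i - t * \sum_i v.1.1 i * p i.
    by rewrite -sumlin; apply: eq_bigr => i _; rewrite l1.
  have s2 : \sum_i (u - t *: v).1.2 i * q i =
      \sum_i u.1.2 i * q i - t * \sum_i v.1.2 i * q i.
    by rewrite -sumlin; apply: eq_bigr => i _; rewrite l2.
  by rewrite /b s1 s2 l3; ring.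
have [x ax|l [l0 bE]] := farkas us alin blin.
  have x2 : 0 <= x.2 by have := ax None (mem_head _ _); rewrite /a oppr_le0.
  have xx i j : x.1.1 i + x.1.2 j <= c i j * x.2.
    rewrite -subr_le0; apply: (ax (Some (i, j))).
    by rewrite in_cons map_f ?orbT// mem_index_enum.
  (* If [x.2 > 0], rescale to a genuine dual pair. If [x.2 = 0] then [u i + v j <= 0] for all [i],
     [j], and averaging against [p i * q j] gives the claim. *)
  rewrite /b subr_le0; move: x2; rewrite le_eqVlt => /predU1P[x2|x2].
    have -> : \sum_i x.1.1 i * p i + \sum_j x.1.2 j * q j =
        \sum_i \sum_j (x.1.1 i + x.1.2 j) * (p i * q j).
      under eq_bigr do rewrite -[X in _ * X]mulr1 -q1 !mulr_sumr.
      under [X in _ + X]eq_bigr do rewrite -[X in _ * X]mul1r -p1 mulr_suml mulr_sumr.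
      rewrite [X in _ + X]exchange_big -big_split; apply: eq_bigr => i _ /=.
      by rewrite -big_split; apply: eq_bigr => j _ /=; ring.
    rewrite -x2 mulr0; apply: sumr_le0 => i _; apply: sumr_le0 => j _.
    by rewrite mulr_le0_ge0 ?mulr_ge0// (le_trans (xx i j))// -x2 mulr0.
  rewrite -ler_pdivrMr// mulrDl !mulr_suml.
  have := dual (fun i => x.1.1 i / x.2) (fun j => x.1.2 j / x.2).
  under eq_bigr do rewrite mulrAC.
  under [X in _ + X <= _]eq_bigr do rewrite mulrAC.
  by apply=> i j; rewrite -mulrDl ler_pdivrMr.
(* Evaluating the Farkas identity at basis vectors reads off the two marginals, and at [(0, 0, 1)]
   the cost. *)
pose dl i : {ffun I -> F^o} := [ffun j => (j == i)%:R].
have dlE i (r : I -> F) : \sum_j dl i j * r j = r i.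
  rewrite (bigD1 i)//= ffunE eqxx mul1r big1 ?addr0// => j ji.
  by rewrite ffunE (negPf ji) mul0r.
have z0 (r : I -> F) : \sum_j (0 : {ffun I -> F^o}) j * r j = 0.
  by rewrite big1// => j _; rewrite ffunE mul0r.
exists (fun i j => l (Some (i, j))); split=> [i j|i|j|].
- exact: l0.
- have := bE (dl i, 0, 0 : F^o); rewrite /b /= dlE z0 sE /= mulr0 oppr0 mulr0.
  rewrite !addr0 add0r => ->; rewrite [RHS](bigD1 i)//= [X in _ = _ + X]big1 ?addr0.
    by apply: eq_bigr => j _; rewrite !ffunE eqxx mulr0 subr0 addr0 mulr1.
  move=> k ki; rewrite big1// => j _.
  by rewrite !ffunE (negPf ki) mulr0 subr0 addr0 mulr0.
- have := bE (0, dl j, 0 : F^o); rewrite /b /= dlE z0 sE /= mulr0 oppr0 mulr0.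
  rewrite addr0 !add0r => ->; apply: eq_bigr => i _.
  rewrite (bigD1 j)//= big1 ?addr0.
    by rewrite !ffunE eqxx mulr0 subr0 add0r mulr1.
  by move=> k kj; rewrite !ffunE (negPf kj) mulr0 subr0 addr0 mulr0.
- have := bE (0, 0, 1 : F^o); rewrite /b /= !z0 sE /= add0r mulr1 sub0r.
  rewrite (eq_bigr (fun i => - \sum_j l (Some (i, j)) * c i j)); last first.
    move=> i _; rewrite -sumrN; apply: eq_bigr => j _.
    by rewrite !ffunE addr0 add0r mulr1 mulrN.
  rewrite sumrN mulrN1 => DE; have := l0 None; lra.
Qed.

Lemma mass1_nonempty {d} {T : measurableType d} {R : realType}
    (g : {measure set T -> \bar R}) : g setT = 1%E -> [set: T] !=set0.
Proof.
move=> g1; apply/set0P/eqP => T0; move: g1; rewrite T0 measure0 => /esym/eqP.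
by rewrite onee_eq0.
Qed.

Lemma probability_of_mass1 {d} {T : measurableType d} {R : realType}
    (g : {measure set T -> \bar R}) :
  g setT = 1%E -> exists P : probability T R, forall A, P A = g A.
Proof.
move=> g1.
have [a _] := mass1_nonempty g1.
exists (mnormalize g (\d_a : probability T R)) => A.
by rewrite -[LHS]/(mnormalize g _ A) /mnormalize g1 onee_eq0/= invr1 mule1.
Qed.

Section metric.
Context {dX : measure_display} {X : measurableType dX} {R : realType}.
Implicit Types (d : X -> X -> R) (h : X -> R).

Definition lip d (L : R) h := forall x y, h x <= h y + L * d x y.

(** Preimages of open rays are open for [d], hence Borel. The radius divides by [|L| + 1] to remain
    meaningful when [L = 0]. *)
Lemma measurable_lip d L h : polish_borel d -> lip d L h ->
  measurable_fun setT h.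
Proof.
move=> [[d0 dz ds dt] _ _ mE _] hL.
apply: (measurability _ (RGenOInfty.measurableE R)) => _ /= -[_ [r ->] <-].
rewrite setTI mE; apply: sub_sigma_algebra => x /=; rewrite in_itv/= andbT => rx.
exists ((h x - r) / (`|L| + 1)); split.
  by rewrite divr_gt0 ?subr_gt0// ltr_wpDl ?normr_ge0 ?ltr01.
move=> y; rewrite /dball/= in_itv/= andbT ltr_pdivlMr ?(ltr_wpDl (normr_ge0 _) ltr01)// => xy.
have := hL x y; have := ler_wpM2r (d0 x y) (ler_norm L); have := d0 x y; nra.
Qed.

Lemma lip_dist d a : is_metric d -> lip d 1 (d ^~ a).
Proof. by move=> [_ _ _ dt] x y; rewrite mul1r addrC dt. Qed.

Lemma measurable_dist d a : polish_borel d -> measurable_fun setT (d ^~ a).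
Proof.
by move=> dP; apply: (measurable_lip dP (lip_dist _ _)); case: dP.
Qed.

End metric.

(* On each cell [t^-1 i * t^-1 j], take a multiple of the product measure. *)
Lemma coupling_of_discrete {dX} {X : measurableType dX} {R : realType}
    (mu nu : probability X R) (n : nat) (t : X -> 'I_n.+1) (w : 'I_n.+1 -> 'I_n.+1 -> R) :
  (forall i, measurable (t @^-1` [set i])) ->
  (forall i j, 0 <= w i j) ->
  (forall i, (\sum_j w i j)%:E = mu (t @^-1` [set i])) ->
  (forall j, (\sum_i w i j)%:E = nu (t @^-1` [set j])) ->
  exists g : probability (X * X)%type R, coupling mu nu g /\
    forall i j, g ((t @^-1` [set i]) `*` (t @^-1` [set j])) = (w i j)%:E.
Proof.
move=> mt w0 wp wq.
pose p i := \sum_j w i j; pose q j := \sum_i w i j.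
have p0 i : 0 <= p i by exact: sumr_ge0.
have q0 i : 0 <= q i by exact: sumr_ge0.
have wp0 i j : p i = 0 -> w i j = 0.
  by move=> /eqP; rewrite psumr_eq0// => /allP/(_ j (mem_index_enum _))/eqP.
have wq0 i j : q j = 0 -> w i j = 0.
  by move=> /eqP; rewrite psumr_eq0// => /allP/(_ i (mem_index_enum _))/eqP.
(* If [p i] or [q j] vanishes this quotient is 0 by convention, which is the right value: by [wp0]
   and [wq0], [w i j] vanishes too. *)
pose c i j := w i j / (p i * q j).
have c0 i j : 0 <= c i j by rewrite divr_ge0// mulr_ge0.
pose C i := t @^-1` [set i].
have mC1 i : measurable (C i) by exact: mt.
have mC (i j : 'I_n.+1) : measurable (C i `*` C j) by exact: measurableX.
pose g : {measure set (X * X) -> \bar R} :=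
  msum (fun i => msum (fun j =>
    mscale (NngNum (c0 (inord i) (inord j)))
     (mrestr (mu \x nu)%E (mC (inord i) (inord j)))) n.+1) n.+1.
have gE A B : measurable A -> measurable B -> g (A `*` B) =
    (\sum_i \sum_j (c i j)%:E * (mu (A `&` C i) * nu (B `&` C j)))%E.
  move=> mA mB; rewrite /g/= /msum; apply: eq_bigr => i _; apply: eq_bigr => j _.
  rewrite !inord_val.
  rewrite -[LHS]/((c i j)%:E * (mu \x nu) ((A `*` B) `&` (C i `*` C j)))%E.
  rewrite -setXI product_measure1E//; exact: measurableI.
have splitE (P : probability X R) A : measurable A ->
    P A = (\sum_i P (A `&` C i))%E.
  move=> mA.
  have AE : A = \bigcup_(i in [set` index_enum 'I_n.+1]) (A `&` C i).
    apply/seteqP; split => [x Ax|x [i _ []]//].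
    by exists (t x) => //=; exact: mem_index_enum.
  rewrite {1}AE measure_fin_bigcup//=.
  - by rewrite -fsbig_seq// index_enum_uniq.
  - by move=> i j _ _ [x [[_ <-] [_ <-]]].
  - by move=> i _; exact: measurableI.
have pE i : mu (C i) = (p i)%:E by rewrite wp.
have qE i : nu (C i) = (q i)%:E by rewrite wq.
have gcpl A : measurable A -> g (A `*` setT) = mu A /\ g (setT `*` A) = nu A.
  move=> mA; rewrite !gE//; split.
    rewrite (splitE mu A)//; apply: eq_bigr => i _.
    have [pi0|pi0] := eqVneq (p i) 0.
      have -> : mu (A `&` C i) = 0%E.
        apply/eqP; rewrite eq_le measure_ge0 andbT -[X in (_ <= X)%E](_ : mu (C i) = 0%E).
          by rewrite le_measure// ?inE//; exact: measurableI.
        by rewrite pE pi0.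
      by rewrite big1// => j _; rewrite mul0e mule0.
    have [a ->] : exists a : R, mu (A `&` C i) = a%:E.
      by exists (fine (mu (A `&` C i))); rewrite fineK// fin_num_measure//; exact: measurableI.
    under eq_bigr do rewrite setTI qE -!EFinM.
    rewrite sumEFin; congr _%:E.
    rewrite (eq_bigr (fun j => a / p i * w i j)) => [|j _].
      by rewrite -mulr_sumr -/(p i) divfK.
    have [qj0|qj0] := eqVneq (q j) 0; first by rewrite /c wq0// qj0; ring.
    by rewrite /c; field; rewrite pi0.
  rewrite exchange_big (splitE nu A)//; apply: eq_bigr => j _.
  have [qj0|qj0] := eqVneq (q j) 0.
    have -> : nu (A `&` C j) = 0%E.
      apply/eqP; rewrite eq_le measure_ge0 andbT -[X in (_ <= X)%E](_ : nu (C j) = 0%E).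
        by rewrite le_measure// ?inE//; exact: measurableI.
      by rewrite qE qj0.
    by rewrite big1// => i _; rewrite !mule0.
  have [a ->] : exists a : R, nu (A `&` C j) = a%:E.
    by exists (fine (nu (A `&` C j))); rewrite fineK// fin_num_measure//; exact: measurableI.
  under eq_bigr do rewrite setTI pE -!EFinM.
  rewrite sumEFin; congr _%:E.
  rewrite (eq_bigr (fun i => a / q j * w i j)) => [|i _].
    by rewrite -mulr_sumr -/(q j) divfK.
  have [pi0|pi0] := eqVneq (p i) 0; first by rewrite /c wp0// pi0; ring.
  by rewrite /c; field; rewrite qj0.
have g1 : g setT = 1%E.
  by rewrite -setXTT; have [-> _] := gcpl _ measurableT; exact: probability_setT.
have [P PE] := probability_of_mass1 g1.
exists P; split.
  by move=> A mA; rewrite !PE; exact: gcpl.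
move=> i j; rewrite PE -/(C i) -/(C j) gE; [|exact: mt|exact: mt].
rewrite (bigD1 i)//= (bigD1 j)//= [X in (_ + X)%E]big1 ?adde0; last first.
  move=> k ki; rewrite big1// => l _.
  rewrite (_ : C i `&` C k = set0) ?measure0 ?mul0e ?mule0//.
  by apply/seteqP; split=> // x [/= xi xk]; move: ki; rewrite -xi -xk eqxx.
rewrite [X in (_ + X)%E]big1 ?adde0; last first.
  move=> l lj; rewrite [X in nu X](_ : C j `&` C l = set0) ?measure0 ?mule0//.
  by apply/seteqP; split=> // x [/= xi xk]; move: lj; rewrite -xi -xk eqxx.
rewrite !setIid pE qE -!EFinM; congr _%:E.
have [pi0|pi0] := eqVneq (p i) 0; first by rewrite wp0// pi0; ring.
have [qj0|qj0] := eqVneq (q j) 0; first by rewrite wq0// qj0; ring.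
by rewrite /c; field; rewrite qj0 pi0.
Qed.

Lemma integral_prob_cst {d} {T : measurableType d} {R : realType}
    (P : probability T R) (r : R) : (\int[P]_x r%:E = r%:E)%E.
Proof.
by rewrite integral_cst// -[RHS]mule1; congr (_ * _)%E; exact: probability_setT.
Qed.

Lemma ge0_le_integralD {d} {T : measurableType d} {R : realType}
    (mu : {measure set T -> \bar R}) (f g h : T -> R) :
  measurable_fun setT f -> measurable_fun setT g -> measurable_fun setT h ->
  (forall x, 0 <= f x) -> (forall x, 0 <= g x) -> (forall x, 0 <= h x) ->
  (forall x, f x <= g x + h x) ->
  (\int[mu]_x (f x)%:E <= \int[mu]_x (g x)%:E + \int[mu]_x (h x)%:E)%E.
Proof.
move=> mf mg mh f0 g0 h0 fgh.
rewrite -ge0_integralD//; [|by move=> x _; rewrite lee_fin|exact/measurable_EFinP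
  |by move=> x _; rewrite lee_fin|exact/measurable_EFinP].
apply: ge0_le_integral => //.
- by move=> x _; rewrite lee_fin.
- exact/measurable_EFinP.
- by apply: emeasurable_funD; exact/measurable_EFinP.
- by move=> x _; rewrite -EFinD lee_fin.
Qed.

Lemma measurable_discrete {d} {T : measurableType d} {R : realType}
    (I : finType) (t : T -> I) (F : I -> R) :
  (forall i, measurable (t @^-1` [set i])) ->
  measurable_fun setT (fun x => F (t x)).
Proof.
move=> mt.
rewrite (_ : (fun x => _) =
    fun x => \sum_(i <- index_enum I) F i * \1_(t @^-1` [set i]) x).
  by apply: measurable_sum => i; exact: measurable_funM.
apply/funext => x; rewrite (bigD1 (t x))//= indicE mem_set//.
rewrite mulr1 big1 ?addr0// => i ix; rewrite indicE memNset ?mulr0//=.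
by move=> xi; rewrite xi eqxx in ix.
Qed.

Lemma ge0_integral_discrete {d} {T : measurableType d} {R : realType}
    (mu : {measure set T -> \bar R}) (I : finType) (t : T -> I) (F : I -> R) :
  (forall i, measurable (t @^-1` [set i])) -> (forall i, 0 <= F i) ->
  (\int[mu]_x (F (t x))%:E = \sum_i (F i)%:E * mu (t @^-1` [set i]))%E.
Proof.
move=> mt F0.
transitivity (\int[mu]_x (\sum_(i <- index_enum I) (F i * \1_(t @^-1` [set i]) x)%:E))%E.
  apply: eq_integral => x _; rewrite sumEFin (bigD1 (t x))//= indicE mem_set//.
  rewrite mulr1 big1 ?addr0// => i ix; rewrite indicE memNset ?mulr0//=.
  by move=> xi; rewrite xi eqxx in ix.
rewrite ge0_integral_sum//=.
- apply: eq_bigr => i _.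
  under eq_integral do rewrite EFinM.
  rewrite ge0_integralZl//= ?lee_fin//; last exact/measurable_EFinP.
  by rewrite integral_indic// setIT.
- move=> i; apply/measurable_EFinP; exact: measurable_funM.
- by move=> i x _; rewrite lee_fin mulr_ge0.
Qed.

Lemma ge0_integral_coupling1 {d} {T : measurableType d} {R : realType}
    (mu nu : {measure set T -> \bar R}) (g : probability (T * T)%type R) (f : T -> \bar R) :
  coupling mu nu g -> measurable_fun setT f -> (forall x, 0 <= f x)%E ->
  (\int[g]_z f z.1 = \int[mu]_x f x)%E.
Proof.
move=> gc mf f0.
have /= := ge0_integral_pushforward (@measurable_fst _ _ T T) g measurableT mf (fun x _ => f0 x).
rewrite preimage_setT => <-; apply: eq_measure_integral => A mA _ /=.
by rewrite /pushforward -(gc A mA).1; congr (g _); apply/seteqP; split=> [x|x []].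
Qed.

Lemma ge0_integral_coupling2 {d} {T : measurableType d} {R : realType}
    (mu nu : {measure set T -> \bar R}) (g : probability (T * T)%type R) (f : T -> \bar R) :
  coupling mu nu g -> measurable_fun setT f -> (forall x, 0 <= f x)%E ->
  (\int[g]_z f z.2 = \int[nu]_x f x)%E.
Proof.
move=> gc mf f0.
have /= := ge0_integral_pushforward (@measurable_snd _ _ T T) g measurableT mf (fun x _ => f0 x).
rewrite preimage_setT => <-; apply: eq_measure_integral => A mA _ /=.
by rewrite /pushforward -(gc A mA).2; congr (g _); apply/seteqP; split=> [x|x []].
Qed.

Section kantorovich.
Context {dX : measure_display} {X : measurableType dX} {R : realType}.
Variable d : X -> X -> R.
Hypothesis dP : polish_borel d.

(** [t n x] indexes a closest point to [x] among the first [n + 1] terms of a dense sequence.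
    Updating it recursively makes measurability an induction; density gives the convergence, and
    comparison with [s 0] supplies a dominating function. *)
Lemma nearest_sequence : exists (s : nat -> X) (t : forall n, X -> 'I_n.+1),
  [/\ forall n i, measurable (t n @^-1` [set i]),
      forall n, measurable_fun setT (fun x => d x (s (t n x))),
      forall n x, d x (s (t n x)) <= d x (s 0%N) &
      forall x, d x (s (t n x)) @[n --> \oo] --> (0 : R)].
Proof.
have [dm _ [s sd] _ _] := dP; have [d0 dz ds dt] := dm.
pose fix t (n : nat) (x : X) {struct n} : nat := if n is n'.+1 then
  if d x (s n) < d x (s (t n' x)) then n else t n' x else 0%N.
have tn n x : (t n x < n.+1)%N.
  by elim: n => //= n IH; case: ifP => // _; rewrite ltnS ltnW.
have me n : measurable_fun setT (fun x => d x (s (t n x))).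
  elim: n => [|n IH] /=; first exact: measurable_dist.
  rewrite (_ : (fun x => _) = (fun x => if d x (s n.+1) < d x (s (t n x))
    then d x (s n.+1) else d x (s (t n x)))); last first.
    by apply/funext => x; case: ifP.
  apply: measurable_fun_ifT => //; last exact: measurable_dist.
  by apply: measurable_fun_ltr => //; exact: measurable_dist.
have mt n : measurable_fun setT (t n).
  elim: n => [|n IH] /=; first exact: measurable_cst.
  apply: measurable_fun_ifT => //.
  by apply: measurable_fun_ltr => //; exact: measurable_dist.
have le n x i : (i <= n)%N -> d x (s (t n x)) <= d x (s i).
  elim: n => [|n IH] /=; first by rewrite leqn0 => /eqP ->.
  rewrite leq_eqVlt => /predU1P[->|]; first by case: ltP.
  by rewrite ltnS => /IH; case: ltP => // /ltW; exact: le_trans.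
exists s, (fun n x => inord (t n x)); split=> [n i|n|n x|x].
- rewrite (_ : _ @^-1` _ = setT `&` t n @^-1` [set (i : nat)]).
    exact: mt.
  rewrite setTI; apply/seteqP; split=> x /=; first by move <-; rewrite inordK.
  by move=> tni; apply: val_inj; rewrite /= inordK.
- rewrite (_ : (fun x => _) = fun x => d x (s (t n x))) //; apply/funext => x.
  by rewrite inordK.
- by rewrite inordK// le.
- apply/cvgrPdist_lt => e e0; have [N xN] := sd x e e0.
  near=> n; rewrite sub0r normrN ger0_norm// inordK//.
  by apply: le_lt_trans xN; apply: le; near: n; exact: nbhs_infty_ge.
Unshelve. all: by end_near. Qed.

(* The potential [x |-> min_j (d x (s j) - v j)] extends the dual pair [u, v]
   of the discretized problem to a Lipschitz function on the whole space; the
   shift by [K] makes it nonnegative. *)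
Lemma W1_discretization (mu nu : probability X R) (n : nat) (s : 'I_n.+1 -> X)
    (t : X -> 'I_n.+1) (D a b : R) :
  (forall i, measurable (t @^-1` [set i])) ->
  measurable_fun setT (fun x => d x (s (t x))) ->
  (\int[mu]_x (d x (s (t x)))%:E = a%:E)%E ->
  (\int[nu]_x (d x (s (t x)))%:E = b%:E)%E ->
  (forall K h, lip d 1 h -> (forall x, (0 <= h x <= K)%R) ->
    \int[mu]_x (h x)%:E <= \int[nu]_x (h x)%:E + D%:E)%E ->
  (W1 d mu nu <= (D + 2 * (a + b))%R%:E)%E.
Proof.
move=> mt me ea eb dual.
have [[d0 dz ds dt] _ _ _ md] := dP.
pose p (P : probability X R) i := fine (P (t @^-1` [set i])).
have pE (P : probability X R) i : (p P i)%:E = P (t @^-1` [set i]).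
  by rewrite fineK// fin_num_measure.
have p0 (P : probability X R) i : 0 <= p P i by rewrite fine_ge0.
have intE (P : probability X R) (F : 'I_n.+1 -> R) : (forall i, 0 <= F i) ->
    (\int[P]_x (F (t x))%:E = (\sum_i F i * p P i)%R%:E)%E.
  move=> F0; rewrite ge0_integral_discrete// -sumEFin.
  by apply: eq_bigr => i _; rewrite EFinM pE.
have p1 (P : probability X R) : \sum_i p P i = 1.
  have /= := intE P (fun=> 1) (fun=> ler01).
  under [X in _ = X%:E -> _]eq_bigr do rewrite mul1r.
  rewrite integral_cst// mul1e => pP; apply: EFin_inj; rewrite -pP.
  exact: probability_setT.
(* The error [a + b] is paid twice: here, because the potential is evaluated at [s (t x)] instead of
   [x], and again when the finite plan is lifted to a coupling of [mu] and [nu]. *)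
have [||||u v uv|w [w0 wp wq wc]] := @finite_kantorovich R 'I_n.+1
    (fun i j => d (s i) (s j)) (p mu) (p nu) (D + (a + b)) => //.
  pose K := \sum_i `|u i| + \sum_i `|v i|.
  have uK i : u i <= K.
    rewrite /K (bigD1 i)//= -addrA (le_trans (ler_norm _))// lerDl.
    by rewrite addr_ge0// sumr_ge0.
  have vK i : v i <= K.
    rewrite /K [in X in _ + X](bigD1 i)//= addrCA (le_trans (ler_norm _))// lerDl.
    by rewrite addr_ge0// sumr_ge0.
  have K0 : 0 <= K by rewrite addr_ge0// sumr_ge0.
  (* Since [v j <= K] every term is nonnegative; since [u i <= K] the cap [2 * K] never cuts below
     [u i + K]. *)
  pose h x := \big[Num.min/2 * K]_j (d x (s j) + (K - v j)).
  have h0 x : 0 <= h x.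
    rewrite /h; elim/big_ind: _ => [|y z y0 z0|i _].
    - by rewrite mulr_ge0.
    - by rewrite le_min y0.
    - by rewrite addr_ge0// subr_ge0.
  have hK x : h x <= 2 * K by exact: bigmin_le_id.
  have hle x i : h x <= d x (s i) + (K - v i) by exact: bigmin_le_cond.
  have hlip : lip d 1 h.
    move=> x y; rewrite mul1r -lerBlDr [X in _ <= X]/h.
    elim/big_ind: _ => [|z z' hz hz'|i _].
    - by rewrite lerBlDr (le_trans (hK x))// lerDl.
    - by rewrite le_min hz.
    - by have := hle x i; have := dt x y (s i); lra.
  (* The constraint [u i + v j <= d (s i) (s j)] puts [h] above [u + K] on the atoms, while the term
     [j] of the minimum puts it below [K - v]. Comparing the integrals of [h] thus bounds the dual
     value. *)
  have hs i : u i + K <= h (s i).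
    rewrite /h; elim/big_ind: _ => [|z z' hz hz'|j _].
    - by have := uK i; lra.
    - by rewrite le_min hz.
    - by have := uv i j; lra.
  have hs' j : h (s j) <= K - v j.
    by rewrite (le_trans (hle _ j))// (dz _ _).2// add0r.
  have mh : measurable_fun setT h by exact: measurable_lip hlip.
  have mhs : measurable_fun setT (fun x => h (s (t x))).
    exact: (measurable_discrete (h \o s)).
  have H1 : (\int[mu]_x (h (s (t x)))%:E <= \int[mu]_x (h x)%:E + a%:E)%E.
    rewrite -ea; apply: ge0_le_integralD => // x.
    by have := hlip (s (t x)) x; rewrite mul1r ds.
  have H2 : (\int[nu]_x (h x)%:E <= \int[nu]_x (h (s (t x)))%:E + b%:E)%E.
    rewrite -eb; apply: ge0_le_integralD => // x.
    by have := hlip x (s (t x)); rewrite mul1r.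
  have H3 : (\int[mu]_x (h (s (t x)))%:E <=
      \int[nu]_x (h (s (t x)))%:E + b%:E + D%:E + a%:E)%E.
    apply: (le_trans H1); rewrite leeD2r//; apply: (le_trans (dual (2 * K) _ hlip _)).
      by move=> x; rewrite h0 hK.
    by rewrite leeD2r.
  move: H3; rewrite !(intE _ (h \o s))//= -!EFinD lee_fin => H3.
  have U : \sum_i u i * p mu i + K <= \sum_i h (s i) * p mu i.
    rewrite -[X in _ + X]mulr1 -(p1 mu) mulr_sumr -big_split/=.
    by apply: ler_sum => i _; rewrite -mulrDl ler_wpM2r.
  have W : \sum_i h (s i) * p nu i + \sum_j v j * p nu j <= K.
    rewrite -[X in _ <= X]mulr1 -(p1 nu) mulr_sumr -big_split/=.
    by apply: ler_sum => i _; rewrite -mulrDl ler_wpM2r// -lerBrDr.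
  lra.
have wmu i : (\sum_j w i j)%:E = mu (t @^-1` [set i]) by rewrite wp pE.
have wnu j : (\sum_i w i j)%:E = nu (t @^-1` [set j]) by rewrite wq pE.
have [g [gc gw]] := coupling_of_discrete mt w0 wmu wnu.
apply: (@le_trans _ _ (\int[g]_z (d z.1 z.2)%:E)%E).
  by apply: ereal_inf_lbound; exists g.
have mc : measurable_fun setT (fun z : X * X => d (s (t z.1)) (s (t z.2))).
  apply: (@measurable_discrete _ _ _ _ (fun z : X * X => (t z.1, t z.2))
    (fun ij => d (s ij.1) (s ij.2))) => -[i j].
  rewrite (_ : _ @^-1` _ = (t @^-1` [set i]) `*` (t @^-1` [set j])).
    exact: measurableX.
  by apply/seteqP; split=> z /= [-> ->].
have me1 : measurable_fun setT (fun z : X * X => d z.1 (s (t z.1))).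
  exact: (measurableT_comp me).
have me2 : measurable_fun setT (fun z : X * X => d z.2 (s (t z.2))).
  exact: (measurableT_comp me).
have e1E : (\int[g]_z (d z.1 (s (t z.1)))%:E = a%:E)%E.
  rewrite (ge0_integral_coupling1 (f := fun x => (d x (s (t x)))%:E) gc)//.
    exact/measurable_EFinP.
  by move=> x; rewrite lee_fin.
have e2E : (\int[g]_z (d z.2 (s (t z.2)))%:E = b%:E)%E.
  rewrite (ge0_integral_coupling2 (f := fun x => (d x (s (t x)))%:E) gc)//.
    exact/measurable_EFinP.
  by move=> x; rewrite lee_fin.
have cE : (\int[g]_z (d (s (t z.1)) (s (t z.2)))%:E <= (D + (a + b))%R%:E)%E.
  rewrite (@ge0_integral_discrete _ _ _ _ _ (fun z : X * X => (t z.1, t z.2))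
    (fun ij => d (s ij.1) (s ij.2))) => [|[i j]|//]; last first.
    rewrite (_ : _ @^-1` _ = (t @^-1` [set i]) `*` (t @^-1` [set j])).
      exact: measurableX.
    by apply/seteqP; split=> z /= [-> ->].
  move: wc; rewrite -lee_fin; apply: le_trans.
  rewrite pair_bigA/= -sumEFin; apply: lee_sum => -[i j] _ /=.
  rewrite (_ : _ @^-1` _ = (t @^-1` [set i]) `*` (t @^-1` [set j])).
    by rewrite gw -EFinM mulrC.
  by apply/seteqP; split=> z /= [-> ->].
(* Triangle inequality through the two representatives: the outer legs integrate to [a] and [b], the
   middle one to the cost of the finite plan. *)
apply: (@le_trans _ _ (\int[g]_z (d z.1 (s (t z.1)))%:E +
   \int[g]_z (d (s (t z.1)) (s (t z.2)) + d z.2 (s (t z.2)))%:E)%E).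
  apply: ge0_le_integralD => //=.
  - exact: measurable_funD.
  - by move=> z; rewrite addr_ge0.
  - move=> z; rewrite (le_trans (dt _ (s (t z.1)) _))// lerD2l.
    by rewrite (le_trans (dt _ (s (t z.2)) _))// lerD2l ds.
rewrite e1E; apply: (@le_trans _ _ (a%:E + ((D + (a + b))%:E + b%:E))%E).
  rewrite leeD2l// -e2E.
  apply: (@le_trans _ _ (\int[g]_z (d (s (t z.1)) (s (t z.2)))%:E +
      \int[g]_z (d z.2 (s (t z.2)))%:E)%E); last by rewrite leeD2r.
  apply: ge0_le_integralD => //=; first exact: measurable_funD.
  by move=> z; rewrite addr_ge0.
by rewrite -!EFinD lee_fin; lra.
Qed.

(** The discretization errors tend to 0 by dominated convergence, the first moments making the
    distance to [s 0] integrable. *)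
Lemma kantorovich (mu nu : probability X R) (a : X) (D : R) :
  (\int[mu]_x (d x a)%:E < +oo)%E -> (\int[nu]_x (d x a)%:E < +oo)%E ->
  (forall K h, lip d 1 h -> (forall x, (0 <= h x <= K)%R) ->
    \int[mu]_x (h x)%:E <= \int[nu]_x (h x)%:E + D%:E)%E ->
  (W1 d mu nu <= D%:E)%E.
Proof.
move=> mua nua dual.
have [[d0 _ _ dt] _ _ _ _] := dP.
have [s [t [mt me le0 cvg0]]] := nearest_sequence.
have int0 (P : probability X R) : (\int[P]_x (d x a)%:E < +oo)%E ->
    P.-integrable setT (fun x => (d x (s 0%N))%:E).
  move=> Pa; have md b : measurable_fun setT (d^~ b) by exact: measurable_dist.
  apply/integrableP; split; first exact/measurable_EFinP.
  under eq_integral do rewrite gee0_abs ?lee_fin//.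
  apply: (@le_lt_trans _ _ (\int[P]_x (d x a)%:E + \int[P]_x (d a (s 0%N))%:E)%E).
    by apply: ge0_le_integralD.
  by rewrite lte_add_pinfty// integral_prob_cst ltry.
have cvgE (P : probability X R) : (\int[P]_x (d x a)%:E < +oo)%E ->
    (\int[P]_x (d x (s (t n x)))%:E)%E @[n --> \oo] --> 0%E.
  move=> /int0 Pint; rewrite -[X in _ --> X](integral0 P setT).
  apply: (@dominated_cvg _ _ _ _ _ _ _ _ (fun x => (d x (s 0%N))%:E)) => //.
  - by move=> n; apply/measurable_EFinP.
  - by move=> x _; apply: cvg_EFin => //; [exact: nearW|exact: cvg0].
  - by move=> n x _; rewrite gee0_abs lee_fin// le0.
have fE (P : probability X R) n : (\int[P]_x (d x a)%:E < +oo)%E ->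
    (\int[P]_x (d x (s (t n x)))%:E)%E \is a fin_num.
  move=> /int0/integrableP[_]; rewrite ge0_fin_numE; last first.
    by apply: integral_ge0 => x _; rewrite lee_fin.
  apply: le_lt_trans; apply: ge0_le_integral => //.
  - by move=> x _; rewrite lee_fin.
  - exact/measurable_EFinP.
  - by do 2 apply: measurableT_comp => //; exact: measurable_dist.
  - by move=> x _; rewrite gee0_abs lee_fin// le0.
apply/lee_addgt0Pr => e e0.
(* The total error is [2 * (a + b)], with [a] and [b] each at most [e / 4]. *)
have e4 : 0 < e / 4 by rewrite divr_gt0.
have small (P : probability X R) : (\int[P]_x (d x a)%:E < +oo)%E ->
    \forall n \near \oo, (\int[P]_x (d x (s (t n x)))%:E <= (e / 4)%:E)%E.
  move=> Pa; have /fine_cvgP[_ /cvgr_lt/(_ _ e4)] := cvgE P Pa.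
  by apply: filterS => n /= /ltW; rewrite -lee_fin fineK// fE.
near \oo => n.
apply: (le_trans (W1_discretization (s := fun i => s i) (mt n) (me n) (esym (fineK (fE _ n mua)))
  (esym (fineK (fE _ n nua))) dual)).
have mun : (\int[mu]_x (d x (s (t n x)))%:E <= (e / 4)%:E)%E.
  by near: n; exact: small.
have nun : (\int[nu]_x (d x (s (t n x)))%:E <= (e / 4)%:E)%E.
  by near: n; exact: small.
move: mun nun; rewrite -(fineK (fE _ n mua)) -(fineK (fE _ n nua)).
by rewrite -EFinD !lee_fin; lra.
Unshelve. all: by end_near. Qed.

End kantorovich.

(** * Contraction and transport to the invariant measure *)

Section bind.
Context {dX : measure_display} {X : measurableType dX} {R : realType}.
Variables (nu : probability X R) (m : R.-pker X ~> X).

(** [nu] is viewed as a kernel from a one-point space and [m] as a kernel ignoring that point, so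
    that the integral formula for composed kernels applies to [nu] followed by [m]. *)
Let l : R.-pker unit ~> X := kprobability (measurable_cst (nu : pprobability X R)).
Let k : R.-sfker (unit * X)%type ~> X := kernel.kernel_snd m.

Lemma ge0_integral_invariant (f : X -> \bar R) : mrw_invariant m nu ->
  measurable_fun setT f -> (forall x, 0 <= f x)%E ->
  (\int[nu]_x \int[m x]_y f y = \int[nu]_x f x)%E.
Proof.
move=> inv mf f0; have /= <- := integral_kcomp l k tt f0 mf.
by apply: eq_measure_integral => A mA _ /=; rewrite inv.
Qed.

Let pair_mfun : measurable_fun setT (fun w : (unit * X) * X => (w.1.2, w.2)).
Proof.
apply: measurable_fun_pair => //; exact: measurableT_comp measurable_fst.
Qed.

Let kp : R.-sfker ((unit * X) * X)%type ~> (X * X)%type :=  kdirac pair_mfun.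
Let km : R.-sfker (unit * X)%type ~> (X * X)%type := mkcomp k kp.

(* [nu(dx) m_x(dy)], as a composition of kernels with dummy parameter [tt] *)
Definition flow : {measure set (X * X) -> \bar R} := mkcomp l km tt.

Lemma ge0_integral_flow (f : X * X -> \bar R) :
  measurable_fun setT f -> (forall z, 0 <= f z)%E ->
  (\int[flow]_z f z = \int[nu]_x \int[m x]_y f (x, y))%E.
Proof.
move=> mf f0; have /= -> := integral_kcomp l km tt f0 mf.
apply: eq_integral => x _; have /= -> := integral_kcomp k kp (tt, x) f0 mf.
by apply: eq_integral => y _; rewrite /kdirac integral_dirac// diracT mul1e.
Qed.

Lemma flow_rect A B : measurable A -> measurable B ->
  (flow (A `*` B) = \int[nu]_(x in A) m x B)%E.
Proof.
move=> mA mB; have mAB : measurable (A `*` B) by exact: measurableX.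
transitivity (\int[flow]_z (\1_(A `*` B) z)%:E)%E.
  by rewrite integral_indic// setIT.
rewrite ge0_integral_flow//; last first.
  exact/measurable_EFinP/measurable_indic.
rewrite [RHS]integral_mkcond; apply: eq_integral => x _.
rewrite patchE; case: ifPn => xA.
  rewrite -[B in RHS]setIT -integral_indic//; apply: eq_integral => y _.
  by rewrite !indicE in_setX/= xA.
by apply: integral0_eq => y _; rewrite indicE in_setX/= (negPf xA).
Qed.

Lemma flowT : flow setT = 1%E.
Proof.
rewrite -setXTT flow_rect//.
rewrite -[RHS](integral_prob_cst nu 1); apply: eq_integral => x _.
exact: (prob_kernel x).
Qed.

(** Reversibility says that [flow] and its image under the swap agree on rectangles, a generating
    class stable under intersection; as the measures are finite, they are equal. *)
Lemma ge0_integral_flow_swap (f : X * X -> \bar R) : mrw_reversible m nu ->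
  measurable_fun setT f -> (forall z, 0 <= f z)%E ->
  (\int[flow]_z f (z.2, z.1) = \int[flow]_z f z)%E.
Proof.
move=> rev mf f0.
have msw : measurable_fun setT (fun z : X * X => (z.2, z.1)).
  exact: measurable_fun_pair.
have /= := ge0_integral_pushforward msw flow measurableT mf (fun x _ => f0 x).
rewrite preimage_setT => <-; apply: eq_measure_integral => C mC _.
pose G : set (set (X * X)) :=
  [set C | exists A, measurable A /\ exists B, measurable B /\ C = A `*` B].
apply: (measure_unique G (fun=> setT)) => //.
- rewrite measurable_prod_measurableType //; congr (<<s _ >>).
  rewrite predeqE; split => [[A mA [B mB <-]]|[A [mA [B [mB ->]]]]].
    by exists A; split => //; exists B.
  by exists A => //; exists B.
- move=> _ _ [A1 [mA1 [A2 [mA2 ->]]]] [B1 [mB1 [B2 [mB2 ->]]]].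
  rewrite -setXI; exists (A1 `&` B1); split; first exact: measurableI.
  by exists (A2 `&` B2); split => //; exact: measurableI.
- by move=> _; exists setT; split => //; exists setT; split; rewrite ?setXTT.
- by rewrite bigcup_const//; exists 0%N.
- move=> _ [A [mA [B [mB ->]]]]; rewrite flow_rect// rev// -flow_rect//.
  by rewrite /= /pushforward; congr (flow _); apply/seteqP; split=> [x []|x []].
- by move=> _; rewrite /= /pushforward preimage_setT flowT ltry.
Qed.

End bind.

Section contraction.
Context {dX : measure_display} {X : measurableType dX} {R : realType}.
Variable d : X -> X -> R.
Hypothesis dP : polish_borel d.

Lemma lip_ge0_integral_le_W1 (mu nu : {measure set X -> \bar R}) (h : X -> R) (L K w : R) :
  0 <= L -> lip d L h -> (forall x, 0 <= h x <= K) -> (W1 d mu nu <= w%:E)%E ->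
  (\int[mu]_x (h x)%:E <= \int[nu]_x (h x)%:E + (L * w)%:E)%E.
Proof.
move=> L0 hL h0K W; have [[d0 _ _ _] _ _ _ md] := dP.
have h0 x : 0 <= h x by have /andP[] := h0K x.
have mh : measurable_fun setT h by exact: measurable_lip hL.
apply/lee_addgt0Pr => e e0.
(* A nearly optimal coupling is used, the infimum being possibly not attained; [L + 1] rather than
   [L] covers [L = 0]. *)
have e1 : 0 < e / (L + 1) by rewrite divr_gt0// ltr_wpDl.
have [|_ [g gc <-] gw] := @ereal_inf_lt _
    [set (\int[g]_z (d z.1 z.2)%:E)%E | g in coupling mu nu] (w + e / (L + 1))%:E.
  by apply: le_lt_trans W _; rewrite lte_fin ltrDl.
rewrite -(ge0_integral_coupling1 (f := fun x => (h x)%:E) gc); last 2 first.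
- exact/measurable_EFinP.
- by move=> x; rewrite lee_fin.
rewrite -(ge0_integral_coupling2 (f := fun x => (h x)%:E) gc); last 2 first.
- exact/measurable_EFinP.
- by move=> x; rewrite lee_fin.
apply: (@le_trans _ _ (\int[g]_z (h z.2)%:E + \int[g]_z (L * d z.1 z.2)%:E)%E).
  apply: ge0_le_integralD => //=.
  - exact: (measurableT_comp mh).
  - exact: (measurableT_comp mh).
  - exact: measurable_funM.
  - by move=> z; rewrite mulr_ge0.
rewrite -[leRHS]addeA; apply: leeD2l; under eq_integral do rewrite EFinM.
rewrite ge0_integralZl//=; [|exact/measurable_EFinP|by move=> z _; rewrite lee_fin].
apply: (@le_trans _ _ (L%:E * (w + e / (L + 1))%:E)%E).
  by apply: lee_wpmul2l; [rewrite lee_fin|exact: ltW].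
rewrite -EFinM -EFinD lee_fin mulrDr lerD2l mulrA ler_pdivrMr ?ltr_wpDl//.
by rewrite mulrC ler_pM2l// lerDl.
Qed.

Variables (nu : probability X R) (m : R.-pker X ~> X) (k : R).
Hypotheses (k0 : 0 < k) (k1 : k <= 1).
Hypothesis inv : mrw_invariant m nu.
Hypothesis curv : forall x y, x <> y ->
  (W1 d (m x) (m y) <= ((1 - k) * d x y)%R%:E)%E.

Implicit Types (h : X -> R) (K L : R).

(** Real-valued, so that it can be iterated; for bounded nonnegative measurable [h], [fine] loses
    nothing ([markov_opE]). *)
Definition markov_op (h : X -> R) (x : X) : R := fine (\int[m x]_y (h y)%:E)%E.

Lemma markov_opE h K x : measurable_fun setT h -> (forall x, 0 <= h x <= K) ->
  ((markov_op h x)%:E = \int[m x]_y (h y)%:E)%E.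
Proof.
move=> mh h0K; rewrite fineK// ge0_fin_numE; last first.
  by apply: integral_ge0 => y _; rewrite lee_fin; case/andP: (h0K y).
apply: (@le_lt_trans _ _ (\int[m x]_y K%:E)%E).
  apply: ge0_le_integral => //.
  - by move=> y _; rewrite lee_fin; case/andP: (h0K y).
  - exact/measurable_EFinP.
  - by move=> y _; rewrite lee_fin; case/andP: (h0K y).
by rewrite integral_cst// (prob_kernel x) mule1 ltry.
Qed.

Lemma markov_op_bounded h K x : measurable_fun setT h -> (forall x, 0 <= h x <= K) ->
  0 <= markov_op h x <= K.
Proof.
move=> mh h0K; rewrite -!lee_fin (markov_opE x mh h0K); apply/andP; split.
  by apply: integral_ge0 => y _; rewrite lee_fin; case/andP: (h0K y).
apply: (@le_trans _ _ (\int[m x]_y K%:E)%E).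
  apply: ge0_le_integral => //.
  - by move=> y _; rewrite lee_fin; case/andP: (h0K y).
  - exact/measurable_EFinP.
  - by move=> y _; rewrite lee_fin; case/andP: (h0K y).
by rewrite integral_cst// (prob_kernel x) mule1.
Qed.

Lemma markov_op_lip h K L : 0 <= L -> lip d L h -> (forall x, 0 <= h x <= K) ->
  lip d ((1 - k) * L) (markov_op h).
Proof.
move=> L0 hL h0K x y; have [[d0 dz _ _] _ _ _ _] := dP.
have mh : measurable_fun setT h by exact: measurable_lip hL.
have [->|/curv Wxy] := pselect (x = y).
  by rewrite (dz y y).2// mulr0 addr0.
rewrite -lee_fin EFinD !(markov_opE _ mh h0K) -mulrA mulrCA.
exact: lip_ge0_integral_le_W1 Wxy.
Qed.

Lemma iter_markov_op_bounded h K L n : 0 <= L -> lip d L h ->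
  (forall x, 0 <= h x <= K) ->
  lip d ((1 - k) ^+ n * L) (iter n markov_op h) /\
  (forall x, 0 <= iter n markov_op h x <= K).
Proof.
move=> L0 hL h0K; elim: n => [|n [IHl IHb]] /=; first by rewrite expr0 mul1r.
split=> [|x]; last by apply: markov_op_bounded => //; exact: measurable_lip IHl.
rewrite exprS -mulrA; apply: markov_op_lip IHb => //.
by rewrite mulr_ge0// exprn_ge0// subr_ge0.
Qed.

Lemma integral_iter_markov_op h K L n : 0 <= L -> lip d L h ->
  (forall x, 0 <= h x <= K) ->
  (\int[nu]_x (iter n markov_op h x)%:E = \int[nu]_x (h x)%:E)%E.
Proof.
move=> L0 hL h0K; elim: n => //= n <-.
have [hnL hnK] := iter_markov_op_bounded n L0 hL h0K.
have mhn := measurable_lip dP hnL.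
under eq_integral do rewrite (markov_opE _ mhn hnK).
rewrite ge0_integral_invariant//; first exact/measurable_EFinP.
by move=> x; rewrite lee_fin; case/andP: (hnK x).
Qed.

(* Telescoping along [P^n h], whose Lipschitz constants decay geometrically;
   the remainder [P^n h] tends to a constant, uniformly on balls. *)
Lemma lip_integral_le_invariant (mu : probability X R) (D : R) : 0 <= D ->
  (forall K L h, (0 <= L)%R -> lip d L h -> (forall x, (0 <= h x <= K)%R) ->
    \int[mu]_x (h x)%:E <= \int[mu]_x (markov_op h x)%:E + (L * D)%R%:E)%E ->
  forall K L h, 0 <= L -> lip d L h -> (forall x, (0 <= h x <= K)%R) ->
    (\int[mu]_x (h x)%:E <= \int[nu]_x (h x)%:E + (L * D / k)%R%:E)%E.
Proof.
move=> D0 step K L h L0 hL h0K.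
have [[d0 dz ds dt] _ _ _ _] := dP.
have q0 : 0 <= 1 - k by rewrite subr_ge0.
have qL n : 0 <= (1 - k) ^+ n * L by rewrite mulr_ge0// exprn_ge0.
have hnL n : lip d ((1 - k) ^+ n * L) (iter n markov_op h).
  by case: (iter_markov_op_bounded n L0 hL h0K).
have hnK n x : 0 <= iter n markov_op h x <= K.
  by case: (iter_markov_op_bounded n L0 hL h0K).
have mhn n : measurable_fun setT (iter n markov_op h) by exact: measurable_lip (hnL n).
(* The [i]-th step costs [(1 - k) ^+ i * L * D]; the partial geometric sum is
   [(1 - (1 - k) ^+ n) / k]. *)
have tele n : (\int[mu]_x (h x)%:E <= \int[mu]_x (iter n markov_op h x)%:E +
    (L * D / k * (1 - (1 - k) ^+ n))%R%:E)%E.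
  elim: n => [|n IH] /=; first by rewrite expr0 subrr mulr0 adde0.
  apply: (le_trans IH).
  apply: (le_trans (leeD2r _ (step _ _ _ (qL n) (hnL n) (hnK n)))).
  rewrite -addeA leeD2l// -EFinD lee_fin exprS.
  by rewrite le_eqVlt; apply/orP; left; apply/eqP; field; rewrite gt_eqF.
have [x0 _] := mass1_nonempty (probability_setT nu).
have K0 : 0 <= K by have /andP[] := h0K x0; exact: le_trans.
(* Bounds the deviation of [P^n h] from its value at [x0]. The Lipschitz bound makes it tend to 0
   pointwise; the cap [K] makes it dominated under any probability. *)
pose e n x := Num.min K ((1 - k) ^+ n * L * d x x0).
have e0 n x : 0 <= e n x by rewrite le_min K0 mulr_ge0.
have me n : measurable_fun setT (e n).
  by apply: measurable_minr => //; apply: measurable_funM => //; exact: measurable_dist.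
have hne n x : iter n markov_op h x <= iter n markov_op h x0 + e n x.
  rewrite /e; case: (leP K) => _; last exact: (hnL n).
  have /andP[_ a] := hnK n x; have /andP[b _] := hnK n x0; lra.
have hne0 n x : iter n markov_op h x0 <= iter n markov_op h x + e n x.
  rewrite /e; case: (leP K) => _; last by rewrite ds; exact: (hnL n).
  have /andP[_ a] := hnK n x0; have /andP[b _] := hnK n x; lra.
have main n : (\int[mu]_x (h x)%:E <= \int[nu]_x (h x)%:E + (L * D / k)%R%:E +
   (\int[nu]_x (e n x)%:E + \int[mu]_x (e n x)%:E))%E.
  apply: (le_trans (tele n)).
  have A : (\int[mu]_x (iter n markov_op h x)%:E <=
      (iter n markov_op h x0)%:E + \int[mu]_x (e n x)%:E)%E.
    rewrite -(integral_prob_cst mu (iter n markov_op h x0)).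
    apply: ge0_le_integralD => // x; by case/andP: (hnK n x) (hnK n x0) => ? ? /andP[].
  have B : ((iter n markov_op h x0)%:E <=
      \int[nu]_x (h x)%:E + \int[nu]_x (e n x)%:E)%E.
    rewrite -(integral_iter_markov_op n L0 hL h0K).
    rewrite -(integral_prob_cst nu (iter n markov_op h x0)).
    apply: ge0_le_integralD => // x; by case/andP: (hnK n x) (hnK n x0) => ? ? /andP[].
  apply: (le_trans (leeD2r _ (le_trans A (leeD2r _ B)))).
  rewrite [leRHS]addeAC [in leRHS]addeA; apply: leeD2l.
  rewrite lee_fin ler_piMr ?divr_ge0 ?mulr_ge0 ?(ltW k0)//.
  by rewrite lerBlDr lerDl exprn_ge0.
have cvge (P : probability X R) : (\int[P]_x (e n x)%:E)%E @[n --> \oo] --> 0%E.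
  rewrite -[X in _ --> X](integral0 P setT).
  apply: (@dominated_cvg _ _ _ _ _ _ _ _ (fun x => K%:E)) => //.
  - by move=> n; apply/measurable_EFinP.
  - move=> x _; apply: cvg_EFin; first exact: nearW.
    apply: (@squeeze_cvgr _ _ _ _ (cst 0) (fun n => (1 - k) ^+ n * (L * d x x0))).
    + by apply: nearW => n /=; rewrite e0 /e mulrA ge_min lexx orbT.
    + exact: cvg_cst.
    + rewrite -[X in _ --> X](mul0r (L * d x x0)); apply: cvgMl.
      by apply: cvg_expr; rewrite ger0_norm// ltrBlDr ltrDl.
  - exact: finite_measure_integrable_cst.
  - by move=> n x _; rewrite gee0_abs lee_fin// /e ge_min lexx.
have lim : (\int[nu]_x (h x)%:E + (L * D / k)%R%:E +
   (\int[nu]_x (e n x)%:E + \int[mu]_x (e n x)%:E))%E @[n --> \oo] -->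
   (\int[nu]_x (h x)%:E + (L * D / k)%R%:E)%E.
  rewrite -[X in _ --> X]adde0; apply: cvgeD => //.
  - exact: fin_num_adde_defl.
  - exact: cvg_cst.
  - by rewrite -[X in _ --> X]adde0; apply: cvgeD.
by rewrite -(cvg_lim _ lim)//; apply: lime_ge; [exact: cvgP lim|exact: nearW].
Qed.

Lemma integral_le_truncation (P : probability X R) (f : X -> R) (C : \bar R) :
  measurable_fun setT f -> (forall x, 0 <= f x) ->
  (forall n : nat, \int[P]_x (Num.min n%:R (f x))%:E <= C)%E ->
  (\int[P]_x (f x)%:E <= C)%E.
Proof.
move=> mf f0 leC.
have fE x : (f x)%:E = limn (fun n => (Num.min n%:R (f x))%:E).
  apply/esym/cvg_lim => //; apply: cvg_near_cst; near=> n.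
  by rewrite min_r//; near: n; exact: nbhs_infty_ger.
under eq_integral do rewrite fE.
rewrite monotone_convergence//.
- apply: lime_le; last exact: nearW.
  apply: ereal_nondecreasing_is_cvgn => a b ab; apply: ge0_le_integral => //.
  + by move=> x _; rewrite lee_fin le_min ler0n f0.
  + by apply/measurable_EFinP; exact: measurable_minr.
  + by apply/measurable_EFinP; exact: measurable_minr.
  + by move=> x _; rewrite lee_fin le_min ge_min ler_nat ab/= ge_min lexx orbT.
- by move=> n; apply/measurable_EFinP; exact: measurable_minr.
- by move=> n x _; rewrite lee_fin le_min ler0n f0.
- by move=> x _ a b ab; rewrite lee_fin le_min ge_min ler_nat ab/= ge_min lexx orbT.
Unshelve. all: by end_near. Qed.

Lemma dist_trunc_lip a (r : R) : lip d 1 (fun x => Num.min r (d x a)).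
Proof.
move=> x y; rewrite mul1r; have [[d0 _ _ dt] _ _ _ _] := dP.
have := dt x y a; have := d0 x y.
case: (leP r (d x a)) => ?; case: (leP r (d y a)) => ?; lra.
Qed.

Lemma invariant_first_moment a : first_moments d m ->
  (\int[nu]_x (d x a)%:E < +oo)%E.
Proof.
move=> fm; have [[d0 dz ds dt] _ _ _ _] := dP.
have Ma0 : (0 <= \int[m a]_y (d a y)%:E)%E.
  by apply: integral_ge0 => y _; rewrite lee_fin.
have [M ME] : exists M : R, (\int[m a]_y (d a y)%:E = M%:E)%E.
  by exists (fine (\int[m a]_y (d a y)%:E)%E); rewrite fineK// ge0_fin_numE// fm.
have M0 : 0 <= M by rewrite -lee_fin -ME.
have md x : measurable_fun setT (d x).
  rewrite (_ : d x = d ^~ x); first exact: measurable_dist.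
  by apply/funext => y; rewrite ds.
have step (K L : R) h : 0 <= L -> lip d L h -> (forall x, 0 <= h x <= K) ->
    (\int[\d_a]_x (h x)%:E <= \int[\d_a]_x (markov_op h x)%:E + (L * M)%R%:E)%E.
  move=> L0 hL h0K; have mh := measurable_lip dP hL.
  have mPh := measurable_lip dP (markov_op_lip L0 hL h0K).
  have h0 x : 0 <= h x by case/andP: (h0K x).
  rewrite !integral_dirac//=; [|exact/measurable_EFinP|exact/measurable_EFinP].
  rewrite diracT !mul1e (markov_opE _ mh h0K) EFinM -ME.
  rewrite -ge0_integralZl//=; [|exact/measurable_EFinP|by move=> x _; rewrite lee_fin].
  rewrite -[leLHS]mule1 -(prob_kernel (s := m) a) -integral_cst//.
  by apply: ge0_le_integralD => // [|x]; [exact: measurable_funM|rewrite mulr_ge0].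
apply: (@le_lt_trans _ _ (M / k)%:E); last exact: ltry.
apply: integral_le_truncation => // [|n]; first exact: measurable_dist.
have mmin : measurable_fun setT (fun x => Num.min n%:R (d x a)).
  by apply: measurable_minr => //; exact: measurable_dist.
have min0 x : 0 <= Num.min n%:R (d x a) by rewrite le_min ler0n d0.
(* The available inequality bounds the Dirac mass above by [nu], whereas [nu] is to be bounded;
   hence the reflected function. It equals [n] at [a], so adding the integral of the truncated
   distance and cancelling [n] leaves the bound [M / k], uniform in [n]. *)
have hl : lip d 1 (fun x => n%:R - Num.min n%:R (d x a)).
  by move=> x y; have := dist_trunc_lip a n%:R y x; rewrite (ds y x); lra.
have hK x : 0 <= n%:R - Num.min n%:R (d x a) <= (n%:R : R).
  by rewrite subr_ge0 ge_min lexx/= lerBlDr lerDl.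
have := lip_integral_le_invariant M0 step ler01 hl hK.
have mh := measurable_lip dP hl.
rewrite integral_dirac//=; last exact/measurable_EFinP.
rewrite diracT mul1e (dz a a).2// min_r ?ler0n// subr0 mul1r => H.
have := leeD2l (\int[nu]_x (Num.min n%:R (d x a))%:E)%E H.
rewrite addeA -ge0_integralD//=; [|by move=> x _; rewrite lee_fin|exact/measurable_EFinP|
  by move=> x _; rewrite lee_fin; case/andP: (hK x)|exact/measurable_EFinP].
under [X in (_ <= X + _)%E -> _]eq_integral do rewrite -EFinD addrC subrK.
by rewrite integral_prob_cst [X in (X <= _)%E -> _]addeC leeD2lE.
Qed.

Lemma W1_le_invariant (mu : probability X R) (D : R) : first_moments d m ->
  0 <= D ->
  (forall K L h, (0 <= L)%R -> lip d L h -> (forall x, (0 <= h x <= K)%R) ->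
    \int[mu]_x (h x)%:E <= \int[mu]_x (markov_op h x)%:E + (L * D)%R%:E)%E ->
  (W1 d mu nu <= (D / k)%:E)%E.
Proof.
move=> fm D0 step; have [[d0 dz ds dt] _ _ _ _] := dP.
have [a _] := mass1_nonempty (probability_setT nu).
have nua := invariant_first_moment a fm.
have lipnu := lip_integral_le_invariant D0 step.
apply: (kantorovich dP (a := a)) => //; last first.
  by move=> K h hl h0K; have := lipnu K 1 h ler01 hl h0K; rewrite mul1r.
apply: (@le_lt_trans _ _ (\int[nu]_x (d x a)%:E + (D / k)%R%:E)%E); last first.
  by rewrite lte_add_pinfty// ltry.
(* The distance is unbounded, so the comparison with [nu] is applied to its truncations, which are
   1-Lipschitz uniformly in [n]. *)
apply: integral_le_truncation => // [|n]; first exact: measurable_dist.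
have md : measurable_fun setT (d ^~ a) by exact: measurable_dist.
have h0K x : 0 <= Num.min n%:R (d x a) <= n%:R.
  by rewrite le_min ler0n d0/= ge_min lexx.
have := lipnu _ _ _ ler01 (dist_trunc_lip a n%:R) h0K; rewrite mul1r.
move/le_trans; apply; rewrite leeD2r//; apply: ge0_le_integral => //.
- by move=> x _; rewrite lee_fin; case/andP: (h0K x).
- by apply/measurable_EFinP; exact: measurable_minr.
- exact/measurable_EFinP.
- by move=> x _; rewrite lee_fin ge_min lexx orbT.
Qed.

End contraction.

(** * The Fisher information bound *)

(** By uniqueness of densities [f] equals the Radon-Nikodym derivative [nu]-almost everywhere, so
    the change of variables for the latter transfers to [f]. *)
Lemma ge0_integral_density {d} {T : measurableType d} {R : realType}
    (mu nu : probability T R) (f : T -> R) (h : T -> \bar R) :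
  mu `<< nu -> density_of nu mu f -> measurable_fun setT h ->
  (forall x, 0 <= h x)%E ->
  (\int[mu]_x h x = \int[nu]_x (h x * (f x)%:E))%E.
Proof.
move=> munu [mf f0 fE] mh h0.
rewrite -(Radon_Nikodym_SigmaFinite.change_of_variables munu)//.
have gint := Radon_Nikodym_SigmaFinite.f_integrable munu.
have mg := measurable_int _ gint.
have gf : ae_eq nu setT (Radon_Nikodym_SigmaFinite.f mu nu) (EFin \o f).
  apply: integral_ae_eq => //; first exact/measurable_EFinP.
  move=> A _ mA; rewrite -Radon_Nikodym_SigmaFinite.f_integral//.
  exact: fE.
apply: ae_eq_integral => //.
- exact: emeasurable_funM.
- by apply: emeasurable_funM => //; exact/measurable_EFinP.
- exact: ae_eqe_mul2l.
Qed.

Lemma le_sqrt_of_AMGM {R : realType} (A B w : R) : 0 <= A -> 0 <= B ->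
  (forall t, 0 < t -> w <= t * A / 4 + B / t) -> w <= Num.sqrt B * Num.sqrt A.
Proof.
move=> A0 B0 wt; rewrite -(sqr_sqrtr A0) -(sqr_sqrtr B0) in wt.
move: wt (sqrtr_ge0 A) (sqrtr_ge0 B).
move: (Num.sqrt A) (Num.sqrt B) => a b wt a0 b0.
apply/ler_addgt0Pr => e e0.
pose r := e / (a + b + 1).
have r0 : 0 < r by rewrite divr_gt0// ltr_wpDl// addr_ge0.
have re : r * (a + b + 1) = e by rewrite divfK// gt_eqF// ltr_wpDl// addr_ge0.
have ar : 0 < a + r by rewrite ltr_wpDl.
have br : 0 < b + r by rewrite ltr_wpDl.
have t0 : 0 < 2 * (b + r) / (a + r) by rewrite divr_gt0// mulr_gt0.
apply: (le_trans (wt _ t0)).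
have -> : 2 * (b + r) / (a + r) * a ^+ 2 / 4 = (b + r) / 2 * (a ^+ 2 / (a + r)).
  by field; rewrite gt_eqF.
have -> : b ^+ 2 / (2 * (b + r) / (a + r)) = (a + r) / 2 * (b ^+ 2 / (b + r)).
  by field; rewrite !gt_eqF.
have Ha : a ^+ 2 / (a + r) <= a by rewrite ler_pdivrMr//; nra.
have Hb : b ^+ 2 / (b + r) <= b by rewrite ler_pdivrMr//; nra.
have Ha' : (b + r) / 2 * (a ^+ 2 / (a + r)) <= (b + r) / 2 * a.
  by rewrite ler_wpM2l// divr_ge0// ltW.
have Hb' : (a + r) / 2 * (b ^+ 2 / (b + r)) <= (a + r) / 2 * b.
  by rewrite ler_wpM2l// divr_ge0// ltW.
nra.
Qed.

Lemma ge0_integral_EFinD {d} {T : measurableType d} {R : realType}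
    (mu : {measure set T -> \bar R}) (f g : T -> R) :
  measurable_fun setT f -> measurable_fun setT g ->
  (forall x, 0 <= f x) -> (forall x, 0 <= g x) ->
  (\int[mu]_x (f x + g x)%:E = \int[mu]_x (f x)%:E + \int[mu]_x (g x)%:E)%E.
Proof.
move=> mf mg f0 g0; rewrite -ge0_integralD//=.
- by move=> x _; rewrite lee_fin.
- exact/measurable_EFinP.
- by move=> x _; rewrite lee_fin.
- exact/measurable_EFinP.
Qed.

Lemma ge0_integral_EFinZl {d} {T : measurableType d} {R : realType}
    (mu : {measure set T -> \bar R}) (c : R) (f : T -> R) :
  measurable_fun setT f -> (forall x, 0 <= f x) -> 0 <= c ->
  (\int[mu]_x (c * f x)%:E = c%:E * \int[mu]_x (f x)%:E)%E.
Proof.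
move=> mf f0 c0; under eq_integral do rewrite EFinM.
rewrite ge0_integralZl//; first exact/measurable_EFinP.
by move=> x _; rewrite lee_fin.
Qed.

Lemma integral_bounded_fin {d} {T : measurableType d} {R : realType}
    (P : probability T R) (f : T -> R) (K : R) : measurable_fun setT f ->
  (forall x, 0 <= f x <= K) -> exists r : R, (\int[P]_x (f x)%:E = r%:E)%E.
Proof.
move=> mf f0K; exists (fine (\int[P]_x (f x)%:E)%E).
have f0 x : 0 <= f x by case/andP: (f0K x).
rewrite fineK// ge0_fin_numE; last by apply: integral_ge0 => x _; rewrite lee_fin.
apply: (@le_lt_trans _ _ (\int[P]_x K%:E)%E); last by rewrite integral_prob_cst ltry.
apply: ge0_le_integral => //.
- by move=> x _; rewrite lee_fin.
- exact/measurable_EFinP.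
- by move=> x _; rewrite lee_fin; case/andP: (f0K x).
Qed.

(* [a], [b] stand for [sqrt (f x)], [sqrt (f y)] *)
Lemma AMGM_flux {R : realFieldType} (a b p q D L t : R) : 0 <= a -> 0 <= b ->
  0 <= D -> 0 <= L -> 0 < t -> p <= q + L * D -> q <= p + L * D ->
  a ^+ 2 * p + b ^+ 2 * q <= a ^+ 2 * q + b ^+ 2 * p +
    L * (t / 2 * (b - a) ^+ 2 + t^-1 * (D ^+ 2 * a ^+ 2 + D ^+ 2 * b ^+ 2)).
Proof.
move=> a0 b0 D0 L0 t0 pq qp; have r0 : 0 < t^-1 by rewrite invr_gt0.
(* Both signs of [s] are allowed so as to cover [s = |a - b|]. In the identity below, one square is
   AM-GM for [t * s] and [D * (a + b)], the other the defect in [(a + b)^2 <= 2 a^2 + 2 b^2]. *)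
have E1 s : s ^+ 2 = (b - a) ^+ 2 -> D * s * (a + b) <=
    t / 2 * (b - a) ^+ 2 + t^-1 * (D ^+ 2 * a ^+ 2 + D ^+ 2 * b ^+ 2).
  move=> sE; rewrite -sE -subr_ge0.
  have -> : t / 2 * s ^+ 2 + t^-1 * (D ^+ 2 * a ^+ 2 + D ^+ 2 * b ^+ 2) -
      D * s * (a + b) = t^-1 / 2 * ((t * s - D * (a + b)) ^+ 2 + (D * (b - a)) ^+ 2).
    by field; rewrite gt_eqF.
  by rewrite mulr_ge0 ?divr_ge0 ?(ltW r0)// addr_ge0// sqr_ge0.
rewrite addrC -lerBlDl.
have -> : b ^+ 2 * q + a ^+ 2 * p - (a ^+ 2 * q + b ^+ 2 * p) =
  (p - q) * ((a - b) * (a + b)) by ring.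
have [ab|ba] := leP b a.
  have /(ler_wpM2l L0) := E1 (a - b) (ltac:(ring)).
  apply: le_trans.
  have -> : L * (D * (a - b) * (a + b)) = (L * D) * ((a - b) * (a + b)) by ring.
  by apply: ler_wpM2r; [rewrite mulr_ge0 ?subr_ge0 ?addr_ge0|rewrite lerBlDl].
have /(ler_wpM2l L0) := E1 (b - a) erefl.
apply: le_trans.
have -> : L * (D * (b - a) * (a + b)) = (L * D) * ((b - a) * (a + b)) by ring.
have -> : (p - q) * ((a - b) * (a + b)) = (q - p) * ((b - a) * (a + b)) by ring.
by apply: ler_wpM2r; [rewrite mulr_ge0 ?subr_ge0 ?(ltW ba) ?addr_ge0|rewrite lerBlDl].
Qed.

Section fisher.
Context {dX : measure_display} {X : measurableType dX} {R : realType}.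
Variable d : X -> X -> R.
Hypothesis dP : polish_borel d.
Variables (mu nu : probability X R) (m : R.-pker X ~> X) (f : X -> R) (B : R).
Hypothesis munu : mu `<< nu.
Hypothesis muf : density_of nu mu f.
Hypothesis rev : mrw_reversible m nu.
Hypothesis B0 : 0 <= B.
Hypothesis mB : (\forall x \ae nu, \int[m x]_y ((d x y) ^+ 2)%:E <= B%:E)%E.

Let mf : measurable_fun setT f. Proof. by case: muf. Qed.
Let f0 x : 0 <= f x. Proof. by case: muf. Qed.
Let mf1 : measurable_fun setT (fun z : X * X => f z.1).
Proof. exact: (measurableT_comp mf). Qed.
Let mf2 : measurable_fun setT (fun z : X * X => f z.2).
Proof. exact: (measurableT_comp mf). Qed.
Let md : measurable_fun setT (fun z : X * X => d z.1 z.2).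
Proof. by case: dP. Qed.
Let msf : measurable_fun setT (fun x => Num.sqrt (f x)).
Proof.
apply: (measurableT_comp _ mf); apply: continuous_measurable_fun.
exact: sqrt_continuous.
Qed.

Let Q (z : X * X) := (Num.sqrt (f z.2) - Num.sqrt (f z.1)) ^+ 2.

Let mQ : measurable_fun setT Q.
Proof.
apply: measurable_funX; apply: measurable_funB.
  exact: (measurableT_comp msf).
exact: (measurableT_comp msf).
Qed.

Let Q0 z : 0 <= Q z. Proof. exact: sqr_ge0. Qed.

Let S := fun z : X * X => d z.1 z.2 ^+ 2 * f z.1.

Let mS : measurable_fun setT S.
Proof. by apply: measurable_funM => //; exact: measurable_funX. Qed.

Let S0 z : 0 <= S z. Proof. by rewrite mulr_ge0// sqr_ge0. Qed.

Lemma integral_flow_fst (h : X -> R) : measurable_fun setT h ->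
  (forall x, 0 <= h x) ->
  (\int[flow nu m]_z (f z.1 * h z.1)%:E = \int[mu]_x (h x)%:E)%E.
Proof.
move=> mh h0.
rewrite (ge0_integral_flow nu m (f := fun z => (f z.1 * h z.1)%:E)); last 2 first.
- apply/measurable_EFinP; apply: measurable_funM => //.
  exact: (measurableT_comp mh).
- by move=> z; rewrite lee_fin mulr_ge0.
rewrite (ge0_integral_density munu muf); last 2 first.
- exact/measurable_EFinP.
- by move=> x; rewrite lee_fin.
apply: eq_integral => x _ /=; rewrite integral_cst// (prob_kernel x) mule1.
by rewrite -EFinM mulrC.
Qed.

Lemma integral_flow_markov_op (h : X -> R) (K : R) : measurable_fun setT h ->
  (forall x, 0 <= h x <= K) -> measurable_fun setT (markov_op m h) ->
  (\int[flow nu m]_z (f z.1 * h z.2)%:E = \int[mu]_x (markov_op m h x)%:E)%E.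
Proof.
move=> mh h0K mPh; have h0 x : 0 <= h x by case/andP: (h0K x).
rewrite (ge0_integral_flow nu m (f := fun z => (f z.1 * h z.2)%:E)); last 2 first.
- apply/measurable_EFinP; apply: measurable_funM => //.
  exact: (measurableT_comp mh).
- by move=> z; rewrite lee_fin mulr_ge0.
rewrite (ge0_integral_density munu muf); last 2 first.
- exact/measurable_EFinP.
- by move=> x; rewrite (markov_opE m x mh h0K) integral_ge0// => y _; rewrite lee_fin.
apply: eq_integral => x _ /=; rewrite ge0_integral_EFinZl//.
by rewrite muleC (markov_opE m x mh h0K).
Qed.

Lemma integral_flow_S : (\int[flow nu m]_z (S z)%:E <= B%:E)%E.
Proof.
rewrite (ge0_integral_flow nu m (f := EFin \o S)); last 2 first.
- exact/measurable_EFinP.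
- by move=> z; rewrite lee_fin.
have f1 : (\int[nu]_x (f x)%:E = 1)%E.
  have [_ _ /(_ _ measurableT) <-] := muf; exact: probability_setT.
have -> : (B%:E = \int[nu]_x (B * f x)%:E)%E.
  by rewrite ge0_integral_EFinZl// f1 mule1.
have msec x : measurable_fun setT (d x).
  rewrite (_ : d x = d ^~ x); first exact: measurable_dist.
  by apply/funext => y; have [[_ _ ds _] _ _ _ _] := dP; rewrite ds.
apply: ae_ge0_le_integral => //.
- by move=> x _; apply: integral_ge0 => y _; rewrite lee_fin.
- apply: (measurable_fun_integral_sfinite_kernel (EFin \o S) m).
    by move=> z; rewrite lee_fin.
  exact/measurable_EFinP.
- by move=> x _; rewrite lee_fin mulr_ge0.
- by apply/measurable_EFinP; exact: measurable_funM.
apply: filterS mB => x Bx _ /=; rewrite /S/=.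
under eq_integral do rewrite mulrC.
rewrite ge0_integral_EFinZl//.
- by rewrite mulrC EFinM lee_wpmul2l// lee_fin.
- exact: measurable_funX.
- by move=> y; exact: sqr_ge0.
Qed.

Lemma fisher_flow :
  (2%:E * Hm m nu (fun x => Num.sqrt (f x)) = \int[flow nu m]_z (Q z)%:E)%E.
Proof.
rewrite /Hm muleA -EFinM divff// mul1e (ge0_integral_flow nu m (f := EFin \o Q))//.
exact/measurable_EFinP.
Qed.

(** Makes the Fisher information a real number: the integrand is at most [f x + f y], and each term
    integrates to 1, the second by reversibility. *)
Lemma flow_sqrt_le2 : (\int[flow nu m]_z (Q z)%:E <= 2%:E)%E.
Proof.
have := integral_flow_fst (h := fun=> 1) (measurable_cst _) (fun=> ler01).
rewrite integral_prob_cst; under eq_integral do rewrite mulr1; move=> F1.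
have F2 : (\int[flow nu m]_z (f z.2)%:E = 1)%E.
  rewrite -F1 -(ge0_integral_flow_swap (f := fun z => (f z.1)%:E) rev)//.
    exact/measurable_EFinP.
  by move=> z; rewrite lee_fin.
apply: (@le_trans _ _ (\int[flow nu m]_z (f z.1)%:E + \int[flow nu m]_z (f z.2)%:E)%E).
  apply: ge0_le_integralD => // z; rewrite /Q.
  have := sqr_sqrtr (f0 z.1); have := sqr_sqrtr (f0 z.2).
  by have := sqrtr_ge0 (f z.1); have := sqrtr_ge0 (f z.2); nra.
by rewrite F1 F2 -EFinD.
Qed.

(** Integrates [AMGM_flux] against [flow]. By swap invariance each side contains its [mu]-integral
    twice and [B] appears twice, so halving [t / 2 * A + 2 * B / t] gives the stated error. *)
Lemma integral_le_markov_op_fisher (A t K L : R) h : 0 < t -> 0 <= L ->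
  (\int[flow nu m]_z (Q z)%:E = A%:E)%E -> measurable_fun setT (markov_op m h) ->
  lip d L h -> (forall x, 0 <= h x <= K) ->
  (\int[mu]_x (h x)%:E <=
   \int[mu]_x (markov_op m h x)%:E + (L * (t * A / 4 + B / t))%R%:E)%E.
Proof.
move=> t0 L0 QA mPh hL h0K.
have [[d0 dz ds dt] _ _ _ _] := dP.
have mh : measurable_fun setT h by exact: measurable_lip hL.
have h0 x : 0 <= h x by case/andP: (h0K x).
have mh1 : measurable_fun setT (fun z : X * X => h z.1) by exact: (measurableT_comp mh).
have mh2 : measurable_fun setT (fun z : X * X => h z.2) by exact: (measurableT_comp mh).
pose S' (z : X * X) := S (z.2, z.1).
have mS' : measurable_fun setT S'.
  by apply: (measurableT_comp mS); exact: measurable_fun_pair.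
have I1 := integral_flow_fst mh h0.
have I1' : (\int[flow nu m]_z (f z.2 * h z.2)%:E = \int[mu]_x (h x)%:E)%E.
  rewrite -I1 -(ge0_integral_flow_swap (f := fun z => (f z.1 * h z.1)%:E) rev)//.
    by apply/measurable_EFinP; exact: measurable_funM.
  by move=> z; rewrite lee_fin mulr_ge0.
have I2 := integral_flow_markov_op mh h0K mPh.
have I2' : (\int[flow nu m]_z (f z.2 * h z.1)%:E = \int[mu]_x (markov_op m h x)%:E)%E.
  rewrite -I2 -(ge0_integral_flow_swap (f := fun z => (f z.1 * h z.2)%:E) rev)//.
    by apply/measurable_EFinP; exact: measurable_funM.
  by move=> z; rewrite lee_fin mulr_ge0.
have I3 := integral_flow_S.
have I3' : (\int[flow nu m]_z (S' z)%:E <= B%:E)%E.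
  rewrite (ge0_integral_flow_swap (f := fun z => (S z)%:E) rev)//.
  exact/measurable_EFinP.
have mSS : measurable_fun setT (fun z => S z + S' z) by exact: measurable_funD.
have t2 : 0 <= t / 2 by rewrite divr_ge0// ltW.
have r0 : 0 <= t^-1 by rewrite invr_ge0 ltW.
have SS0 z : 0 <= S z + S' z by apply: addr_ge0; exact: S0.
have key : (\int[flow nu m]_z (f z.1 * h z.1 + f z.2 * h z.2)%:E <=
    \int[flow nu m]_z (f z.1 * h z.2 + f z.2 * h z.1)%:E +
    \int[flow nu m]_z (L * (t / 2 * Q z + t^-1 * (S z + S' z)))%:E)%E.
  apply: ge0_le_integralD => //.
  - by apply: measurable_funD; apply: measurable_funM.
  - by apply: measurable_funD; apply: measurable_funM.
  - apply: measurable_funM => //; apply: measurable_funD; apply: measurable_funM => //.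
  - by move=> z; apply: addr_ge0; apply: mulr_ge0.
  - by move=> z; apply: addr_ge0; apply: mulr_ge0.
  - by move=> z; apply: mulr_ge0 => //; apply: addr_ge0; apply: mulr_ge0.
  - move=> [x y]; rewrite /S' /S /Q /= (ds y x).
    have yx : h y <= h x + L * d x y by rewrite ds.
    have := AMGM_flux (sqrtr_ge0 (f x)) (sqrtr_ge0 (f y)) (d0 x y) L0 t0 (hL x y) yx.
    by rewrite !sqr_sqrtr.
(* Boundedness of [h] makes both integrals real, so that the final halving is real arithmetic. *)
have [s sE] := integral_bounded_fin mu mh h0K.
have [T TE] := integral_bounded_fin mu mPh (fun x => markov_op_bounded m x mh h0K).
have L1 : (\int[flow nu m]_z (f z.1 * h z.1 + f z.2 * h z.2)%:E = (s + s)%:E)%E.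
  rewrite ge0_integral_EFinD ?I1 ?I1' ?sE//; first exact: measurable_funM.
  - exact: measurable_funM.
  - by move=> z; apply: mulr_ge0.
  - by move=> z; apply: mulr_ge0.
have L2 : (\int[flow nu m]_z (f z.1 * h z.2 + f z.2 * h z.1)%:E = (T + T)%:E)%E.
  rewrite ge0_integral_EFinD ?I2 ?I2' ?TE//; first exact: measurable_funM.
  - exact: measurable_funM.
  - by move=> z; apply: mulr_ge0.
  - by move=> z; apply: mulr_ge0.
have L3 : (\int[flow nu m]_z (L * (t / 2 * Q z + t^-1 * (S z + S' z)))%:E <=
    (L * (t / 2 * A + t^-1 * (B + B)))%R%:E)%E.
  rewrite ge0_integral_EFinZl//; last 2 first.
  - by apply: measurable_funD; exact: measurable_funM.
  - by move=> z; apply: addr_ge0; apply: mulr_ge0.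
  rewrite EFinM lee_wpmul2l ?lee_fin//.
  rewrite ge0_integral_EFinD//; last 4 first.
  - exact: measurable_funM.
  - exact: measurable_funM.
  - by move=> z; apply: mulr_ge0.
  - by move=> z; apply: mulr_ge0.
  rewrite !ge0_integral_EFinZl// QA EFinD leeD2l// EFinM lee_wpmul2l ?lee_fin//.
  rewrite ge0_integral_EFinD//; first exact: leeD I3 I3'.
  by move=> z; exact: S0.
move: (le_trans key (leeD2l _ L3)); rewrite L1 L2 sE TE -!EFinD !lee_fin => H.
have -> : t * A / 4 + B / t = (t / 2 * A + t^-1 * (B + B)) / 2.
  by field; rewrite gt_eqF.
lra.
Qed.

End fisher.

(** * Curvature as a contraction constant, and the final estimate *)

Lemma W1_ge0 {dX} {X : measurableType dX} {R : realType} (d : X -> X -> R)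
    (mu nu : set X -> \bar R) : is_metric d -> (0 <= W1 d mu nu)%E.
Proof.
move=> [d0 _ _ _]; apply/ereal_infP => _ [g _ <-].
by apply: integral_ge0 => z _; rewrite lee_fin.
Qed.

(** With two distinct points, [kappa] is at most 1 because [W1 >= 0], hence real, and [k] is its
    value. On a space with at most one point the infimum is over the empty set and [kappa] is
    infinite; [k = 1] then serves vacuously, and the disjunction records this case. *)
Lemma kappa_curvature {dX} {X : measurableType dX} {R : realType}
    (d : X -> X -> R) (m : R.-pker X ~> X) :
  is_metric d -> (0 < kappa d m)%E ->
  exists k : R, [/\ 0 < k, k <= 1, (k^-1%:E <= (kappa d m)^-1)%E \/ (forall x y : X, x = y) &
    forall x y, x <> y -> (W1 d (m x) (m y) <= ((1 - k) * d x y)%R%:E)%E].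
Proof.
move=> dm kappa0; have [d0 dz _ _] := dm.
have [[x [y xy]]|noxy] := pselect (exists x y : X, x <> y); last first.
  have all_eq (x y : X) : x = y by apply: contrapT => xy; apply: noxy; exists x, y.
  exists 1; split; [exact: ltr01|exact: lexx|by right|].
  by move=> x y /(_ (all_eq x y)).
have dpos (a b : X) : a <> b -> 0 < d a b.
  by move=> ab; rewrite lt_def d0 andbT; apply/eqP => /dz /ab.
have kle (a b : X) : a <> b -> (kappa d m <= 1 - W1 d (m a) (m b) * ((d a b)^-1)%:E)%E.
  by move=> ab; apply: ereal_inf_lbound; exists a, b.
have k1 : (kappa d m <= 1)%E.
  apply: (le_trans (kle _ _ xy)); rewrite geeDl// oppe_le0 mule_ge0//.
    exact: W1_ge0.
  by rewrite lee_fin invr_ge0.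
have kfin : kappa d m \is a fin_num.
  by rewrite ge0_fin_numE ?(ltW kappa0)// (le_lt_trans k1)// ltry.
rewrite -(fineK kfin) in kappa0 k1 kle *; set k := fine _ in kappa0 k1 kle *.
rewrite lte_fin in kappa0; rewrite lee_fin in k1.
exists k; split => //; first by left; rewrite inver gt_eqF.
move=> a b ab; have dab := dpos _ _ ab; have := kle _ _ ab.
have := W1_ge0 (m a) (m b) dm; case: (W1 d (m a) (m b)) => [w| |]//= w0.
  rewrite -?EFinM -?EFinB !lee_fin => H.
  by rewrite -ler_pdivrMr//; lra.
(* An infinite [W1] would force [kappa] down to [-oo]. *)
by rewrite gt0_mulye ?lte_fin ?invr_gt0.
Qed.

Theorem theorem3p28 (dX : measure_display) (X : measurableType dX) (R : realType)
  (d : X -> X -> R) (m : R.-pker X ~> X) (nu : probability X R) :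
  polish_borel d -> first_moments d m ->
  mrw_invariant m nu -> mrw_reversible m nu ->
  (Theta d m nu < +oo)%E -> (0 < kappa d m)%E ->
  forall mu : probability X R, mu `<< nu ->
  (W1 d mu nu <= sqrte (2%:E * Theta d m nu) * (kappa d m)^-1 * sqrte (Inu m nu mu))%E.
Proof.
move=> dP fm inv rev Thoo kappa0 mu munu.
have [dm _ _ _ _] := dP; have [d0 dz ds dt] := dm.
have [k [k0 k1 kE curv]] := kappa_curvature dm kappa0.
have Th0 : (0 <= Theta d m nu)%E.
  have nuT : (0 < nu setT)%E.
    by have -> : nu setT = 1%E by exact: probability_setT.
  apply: ess_sup_gee; first exact: nuT.
  apply: nearW => x; rewrite mule_ge0 ?lee_fin ?invr_ge0//.
  by apply: integral_ge0 => y _; rewrite lee_fin sqr_ge0.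
have [th thE] : exists th : R, Theta d m nu = th%:E.
  by exists (fine (Theta d m nu)); rewrite fineK// ge0_fin_numE.
have th0 : 0 <= th by rewrite -lee_fin -thE.
have B0 : 0 <= 2 * th by rewrite mulr_ge0.
have mB : (\forall x \ae nu, \int[m x]_y ((d x y) ^+ 2)%:E <= (2 * th)%R%:E)%E.
  have := @ess_sup_ge _ _ _ nu (fun x => ((2^-1)%:E * \int[m x]_y ((d x y) ^+ 2)%:E)%E).
  rewrite -/(Theta d m nu) thE; apply: filterS => x.
  by rewrite EFinM lee_pdivrMl.
(* Proved for every version of the density, because [Inu] is an infimum over versions. *)
have bound f : density_of nu mu f -> exists A : R, [/\ 0 <= A,
    (2%:E * Hm m nu (fun x => Num.sqrt (f x)))%E = A%:E &
    (W1 d mu nu <= ((Num.sqrt (2 * th) * Num.sqrt A) / k)%R%:E)%E].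
  move=> muf.
  pose A := fine (\int[flow nu m]_z ((Num.sqrt (f z.2) - Num.sqrt (f z.1)) ^+ 2)%:E)%E.
  have AE : (\int[flow nu m]_z ((Num.sqrt (f z.2) - Num.sqrt (f z.1)) ^+ 2)%:E = A%:E)%E.
    rewrite fineK// ge0_fin_numE; last first.
      by apply: integral_ge0 => z _; rewrite lee_fin sqr_ge0.
    by rewrite (le_lt_trans (flow_sqrt_le2 munu muf rev))// ltry.
  have A0 : 0 <= A by rewrite -lee_fin -AE; apply: integral_ge0 => z _; rewrite lee_fin sqr_ge0.
  exists A; split => //.
    by rewrite -AE; exact: (fisher_flow _ muf).
  have Wt t : 0 < t -> (W1 d mu nu <= ((t * A / 4 + (2 * th) / t) / k)%R%:E)%E.
    move=> t0; apply: (W1_le_invariant dP k0 k1 inv curv fm).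
      by rewrite addr_ge0 ?divr_ge0 ?mulr_ge0 ?(ltW t0).
    move=> K L h L0 hL h0K.
    apply: (integral_le_markov_op_fisher dP munu muf rev B0 mB t0 L0 AE _ hL h0K).
    exact: measurable_lip dP (markov_op_lip dP curv L0 hL h0K).
  have [w wE] : exists w : R, W1 d mu nu = w%:E.
    exists (fine (W1 d mu nu)); rewrite fineK// ge0_fin_numE ?W1_ge0//.
    by rewrite (le_lt_trans (Wt 1 ltr01))// ltry.
  rewrite wE lee_fin ler_pdivlMr//; apply: le_sqrt_of_AMGM => // t t0.
  by rewrite -ler_pdivlMr// -lee_fin -wE; exact: Wt.
have [f muf] : exists f, density_of nu mu f.
  have g0 := Radon_Nikodym_SigmaFinite.f_ge0 munu.
  have gf := Radon_Nikodym_SigmaFinite.f_fin_num munu.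
  exists (fine \o Radon_Nikodym_SigmaFinite.f mu nu); split.
  - apply: (measurableT_comp (fine_measurable measurableT)).
    exact: measurable_int (Radon_Nikodym_SigmaFinite.f_integrable munu).
  - by move=> x; rewrite fine_ge0.
  - move=> E mE; rewrite (Radon_Nikodym_SigmaFinite.f_integral munu)//.
    by apply: eq_integral => x _ /=; rewrite fineK.
have [A [A0 AE WA]] := bound f muf.
have I0 : (0 <= Inu m nu mu)%E.
  apply/ereal_infP => _ [g mug <-].
  by have [C [C0 -> _]] := bound g mug; rewrite lee_fin.
have IA : (Inu m nu mu <= A%:E)%E by rewrite -AE; apply: ereal_inf_lbound; exists f.
have [i iE] : exists i : R, Inu m nu mu = i%:E.
  by exists (fine (Inu m nu mu)); rewrite fineK// ge0_fin_numE// (le_lt_trans IA)// ltry.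
have i0 : 0 <= i by rewrite -lee_fin -iE.
pose c := Num.sqrt (2 * th) / k.
have c0 : 0 <= c by rewrite divr_ge0// ltW.
have [w wE] : exists w : R, W1 d mu nu = w%:E.
  exists (fine (W1 d mu nu)); rewrite fineK// ge0_fin_numE ?W1_ge0//.
  by rewrite (le_lt_trans WA)// ltry.
have w0 : 0 <= w by rewrite -lee_fin -wE W1_ge0.
(* To pass to the infimum, the bound is rewritten as [(w / c) ^+ 2 <= C] for the value [C] of each
   version; [c = 0] is treated apart because of the division. *)
have wci : w <= c * Num.sqrt i.
  have [c00|cn0] := eqVneq c 0.
    rewrite c00 mul0r; move: WA.
    by rewrite wE lee_fin mulrAC -/c c00 mul0r.
  have cp : 0 < c by rewrite lt_def cn0.
  rewrite mulrC -ler_pdivrMr//.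
  have -> : w / c = Num.sqrt ((w / c) ^+ 2) by rewrite sqrtr_sqr ger0_norm// divr_ge0.
  rewrite ler_wsqrtr//.
  rewrite -lee_fin -iE; apply/ereal_infP => _ [g mug <-].
  have [C [C0 -> WC]] := bound g mug; rewrite lee_fin.
  move: WC; rewrite wE lee_fin mulrAC -/c => wc.
  rewrite -(sqr_sqrtr C0) ler_pXn2r ?nnegrE ?sqrtr_ge0 ?(divr_ge0 w0 c0)//.
  by rewrite ler_pdivrMr// mulrC.
rewrite wE thE iE -EFinM /=.
case: kE => [kE|all_eq].
  apply: (@le_trans _ _ ((Num.sqrt (2 * th))%:E * k^-1%:E * (Num.sqrt i)%:E)%E).
    by rewrite -!EFinM lee_fin.
  by rewrite lee_wpmul2r ?lee_fin ?sqrtr_ge0// lee_wpmul2l ?lee_fin ?sqrtr_ge0.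
(* When all points coincide the Fisher information vanishes, so [W1 <= 0]; of the right-hand side
   only nonnegativity is used. *)
have A00 : A = 0.
  apply: EFin_inj; rewrite -AE /Hm integral0_eq ?mule0// => x _.
  by apply: integral0_eq => y _; rewrite (all_eq y x) subrr expr0n.
apply: (@le_trans _ _ 0%E).
  by move: WA; rewrite wE A00 sqrtr0 mulr0 mul0r.
rewrite mule_ge0// ?lee_fin ?sqrtr_ge0// mule_ge0// ?lee_fin ?sqrtr_ge0//.
by rewrite inve_ge0 ltW.
Qed.
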